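(* Let $p>3$ be a prime and let $\lambda\in\mathbb{F}_p$ with $\lambda\neq 0$ and $\lambda\neq \frac{9}{4}$. Let $E^{\mathrm{DIK}}_{\lambda}: y^2=x^3+3\lambda(x+1)^2$ over $\mathbb{F}_p$ and let $a_p(E^{\mathrm{DIK}}_{\lambda})=p+1-|E^{\mathrm{DIK}}_{\lambda}(\mathbb{F}_p)|$. Then $$\frac{p^2\phi(-3\lambda)}{p-1}\sum_{r=1}^{p-2}\omega^r(6\lambda)\binom{\overline{\omega}^r}{\overline{\omega}^r\phi}\,{}_2G_2(r,1)_p=\frac{\phi(3\lambda)}{p-1}+a_p(E^{\mathrm{DIK}}_{\lambda}),$$ where for $0\le r\le p-2$ and $t\in\mathbb{F}_p$, $${}_2G_2(r,t)_p:={}_2G_2\left[\begin{array}{cc}\frac{r}{p-1} & -\frac12-\frac{r}{p-1}\\ -\frac{r}{2(p-1)} & -\frac{r}{2(p-1)}-\frac12\end{array}\Big|\, t\right]_p .$$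
   Context: Let $p$ be an odd prime. All multiplicative characters of $\mathbb{F}_p^\times$ (including the trivial one) are extended to $\mathbb{F}_p$ by setting $\chi(0)=0$. $\omega:\mathbb{F}_p^\times\to\mathbb{Z}_p^\times$ is the Teichmüller character ($\omega(a)\equiv a \pmod p$), $\overline{\omega}$ its inverse, and $\phi$ the quadratic character of $\mathbb{F}_p$. Fractions such as $\frac94$ denote elements of $\mathbb{F}_p$. For characters $A,B$ of $\mathbb{F}_p$, $J(A,B)=\sum_{x\in\mathbb{F}_p}A(x)B(1-x)$ and $\binom{A}{B}:=\frac{B(-1)}{p}J(A,\overline{B})$. $\Gamma_p$ is Morita's $p$-adic gamma function. For real $x$, $\lfloor x\rfloor$ is the floor and $\langle x\rangle=x-\lfloor x\rfloor$ the fractional part. For $n\ge1$, $a_i,b_i\in\mathbb{Q}\cap\mathbb{Z}_p$ and $t\in\mathbb{F}_p$, $${}_nG_n\left[\begin{array}{c}a_1,\dots,a_n\\ b_1,\dots,b_n\end{array}\Big|\,t\right]_p:=\frac{-1}{p-1}\sum_{j=0}^{p-2}(-1)^{jn}\overline{\omega}^{j}(t)\prod_{i=1}^{n}(-p)^{-\lfloor\langle a_i\rangle-\frac{j}{p-1}\rfloor-\lfloor\langle -b_i\rangle+\frac{j}{p-1}\rfloor}\frac{\Gamma_p(\langle a_i-\frac{j}{p-1}\rangle)}{\Gamma_p(\langle a_i\rangle)}\frac{\Gamma_p(\langle -b_i+\frac{j}{p-1}\rangle)}{\Gamma_p(\langle -b_i\rangle)}.$$ $|E^{\mathrm{DIK}}_{\lambda}(\mathbb{F}_p)|$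 is the number of solutions $(x,y)\in\mathbb{F}_p^2$ of the curve equation plus one (the point at infinity). *)

(* Defs.v *)
From HB Require Import structures.
From mathcomp Require Import all_boot all_order all_algebra cyclic fraction.
From mathcomp Require Import boolp classical_sets.

Set Implicit Arguments.
Unset Strict Implicit.
Unset Printing Implicit Defensive.

Import Order.TTheory GRing.Theory Num.Theory.

Local Open Scope ring_scope.

(* Z_p is the inverse limit of the rings Z/p^n: a p-adic integer is the       *)
(* sequence of its residues modulo p^n, each taken in {0, ..., p^n - 1}.      *)
Record padic_int (p : nat) (p_pr : prime p) := PadicInt {
  padic_res :> nat -> nat;
  padic_resE : forall n, padic_res n = (padic_res n.+1 %% p ^ n)%N }.

Lemma lift_modX p n x y : prime p -> (0 < n)%N ->
  x = y %[mod p ^ n] -> (x ^ p = y ^ p %[mod p ^ n.+1])%N.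
Proof.
move=> p_pr n_gt0; wlog le_yx : x y / (y <= x)%N.
  move=> W; case: (leqP y x) => [/W//|/ltnW le_xy exy].
  by apply/esym/W.
move/eqP; rewrite eqn_mod_dvd// => dvd_xy; apply/eqP.
rewrite eqn_mod_dvd; last by rewrite leq_exp2r ?prime_gt0.
rewrite subn_exp expnSr dvdn_mul//.
have exy : x = y %[mod p].
  apply/eqP; rewrite eqn_mod_dvd//; apply: dvdn_trans dvd_xy.
  by apply: dvdn_exp.
have -> : (p %| \sum_(i < p) x ^ (p.-1 - i) * y ^ i)%N =
          (p %| \sum_(i < p) y ^ p.-1)%N.
  rewrite /dvdn; congr (_ == _).
  rewrite -modn_summ -[RHS]modn_summ; congr (_ %% _)%N; apply: eq_bigr => i _.
  rewrite -modnMml -modnXm exy modnXm modnMml -expnD subnK//.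
  by rewrite -ltnS prednK ?prime_gt0.
by rewrite sum_nat_const card_ord dvdn_mulr.
Qed.

Lemma lift_modXX p k x y : prime p ->
  x = y %[mod p] -> (x ^ (p ^ k) = y ^ (p ^ k) %[mod p ^ k.+1])%N.
Proof.
move=> p_pr exy; elim: k => [|k IH]; first by rewrite expn0 !expn1.
by rewrite expnSr !expnM; apply: lift_modX.
Qed.

Section PadicInt.
Variables (p : nat) (p_pr : prime p).
Local Notation Zp := (padic_int p_pr).
Implicit Types (x y z : Zp) (n m : nat).

Local Lemma p_gt0 : (0 < p)%N. Proof. exact: prime_gt0. Qed.

Lemma padicP x y : (forall n, x n = y n) -> x = y.
Proof.
case: x y => [f hf] [g hg] /= /funext fg; move: hf hg; rewrite fg => hf hg.
by congr PadicInt; exact: Prop_irrelevance.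
Qed.

HB.instance Definition _ := gen_eqMixin Zp.
HB.instance Definition _ := gen_choiceMixin Zp.

Lemma padic_mod x n : (x n %% p ^ n)%N = x n.
Proof. by rewrite padic_resE modn_mod. Qed.

Lemma padic_modS x n : (x n.+1 = x n %[mod p ^ n])%N.
Proof. by rewrite padic_mod -padic_resE. Qed.

Lemma padic_le x n m : (n <= m)%N -> (x m %% p ^ n)%N = x n.
Proof.
move=> /subnK <-; elim: (m - n)%N => [|k IH]; first by rewrite padic_mod.
rewrite addSn -IH [in RHS]padic_resE modn_dvdm//.
by rewrite dvdn_exp2l// leq_addl.
Qed.

Lemma padic_of_subproof (f : nat -> nat) :
  (forall n, (f n.+1 = f n %[mod p ^ n])%N) ->
  forall n, (f n %% p ^ n = (f n.+1 %% p ^ n.+1) %% p ^ n)%N.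
Proof. by move=> hf n; rewrite -hf modn_dvdm// dvdn_exp2l. Qed.

Definition padic_of f hf : Zp :=
  @PadicInt p p_pr (fun n => f n %% p ^ n)%N (@padic_of_subproof f hf).

Fact padic_zero_subproof n : (0 = 0 %[mod p ^ n])%N. Proof. by []. Qed.
Definition padic_zero := padic_of padic_zero_subproof.

Fact padic_one_subproof n : (1 = 1 %[mod p ^ n])%N. Proof. by []. Qed.
Definition padic_one := padic_of padic_one_subproof.

Fact padic_add_subproof x y n :
  (x n.+1 + y n.+1 = x n + y n %[mod p ^ n])%N.
Proof. by rewrite -modnDm !padic_modS modnDm. Qed.
Definition padic_add x y := padic_of (padic_add_subproof x y).

Fact padic_mul_subproof x y n :
  (x n.+1 * y n.+1 = x n * y n %[mod p ^ n])%N.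
Proof. by rewrite -modnMm !padic_modS modnMm. Qed.
Definition padic_mul x y := padic_of (padic_mul_subproof x y).

Lemma padic_res_le x n : (x n <= p ^ n)%N.
Proof. by rewrite -padic_mod ltnW// ltn_mod expn_gt0 p_gt0. Qed.

Fact padic_opp_subproof x n :
  (p ^ n.+1 - x n.+1 = p ^ n - x n %[mod p ^ n])%N.
Proof.
apply/eqP; rewrite -(eqn_modDr (x n)) subnK ?padic_res_le//.
rewrite -modnDmr -padic_modS modnDmr subnK ?padic_res_le//.
by rewrite expnSr modnMr modnn.
Qed.
Definition padic_opp x := padic_of (padic_opp_subproof x).

Fact padic_addA : associative padic_add.
Proof. by move=> x y z; apply: padicP => n /=; rewrite modnDmr modnDml addnA. Qed.
Fact padic_addC : commutative padic_add.
Proof. by move=> x y; apply: padicP => n /=; rewrite addnC. Qed.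
Fact padic_add0 : left_id padic_zero padic_add.
Proof. by move=> x; apply: padicP => n /=; rewrite mod0n add0n padic_mod. Qed.
Fact padic_addN : left_inverse padic_zero padic_opp padic_add.
Proof.
move=> x; apply: padicP => n /=.
by rewrite modnDml subnK ?padic_res_le// modnn mod0n.
Qed.
HB.instance Definition _ :=
  GRing.isZmodule.Build Zp padic_addA padic_addC padic_add0 padic_addN.

Fact padic_mulA : associative padic_mul.
Proof. by move=> x y z; apply: padicP => n /=; rewrite modnMmr modnMml mulnA. Qed.
Fact padic_mulC : commutative padic_mul.
Proof. by move=> x y; apply: padicP => n /=; rewrite mulnC. Qed.
Fact padic_mul1 : left_id padic_one padic_mul.
Proof. by move=> x; apply: padicP => n /=; rewrite modnMml mul1n padic_mod. Qed.
Fact padic_mulD : left_distributive padic_mul padic_add.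
Proof.
by move=> x y z; apply: padicP => n /=; rewrite modnMml modnDm mulnDl.
Qed.
Fact padic_one_neq0 : padic_one != 0.
Proof.
apply/eqP => /(congr1 (fun z : Zp => z 1)) /=.
by rewrite expn1 modn_small ?prime_gt1// mod0n.
Qed.
HB.instance Definition _ := GRing.Zmodule_isComNzRing.Build Zp
  padic_mulA padic_mulC padic_mul1 padic_mulD padic_one_neq0.

Lemma padic_res0 n : (0 : Zp) n = 0%N. Proof. exact: mod0n. Qed.
Lemma padic_res1 n : (1 : Zp) n = (1 %% p ^ n)%N. Proof. by []. Qed.
Lemma padic_resD x y n : (x + y) n = ((x n + y n) %% p ^ n)%N.
Proof. by []. Qed.
Lemma padic_resM x y n : (x * y) n = ((x n * y n) %% p ^ n)%N.
Proof. by []. Qed.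
Lemma padic_resN x n : (- x) n = ((p ^ n - x n) %% p ^ n)%N.
Proof. by []. Qed.
Lemma padic_res_nat m n : (m%:R : Zp) n = (m %% p ^ n)%N.
Proof.
elim: m => [|m IH]; first by rewrite padic_res0 mod0n.
by rewrite -natr1 padic_resD IH padic_res1 modnDm addn1.
Qed.
Lemma padic_resX x k n : (x ^+ k) n = (x n ^ k %% p ^ n)%N.
Proof.
elim: k => [|k IH]; first by rewrite expr0 expn0.
by rewrite exprS padic_resM IH modnMmr expnS.
Qed.

Definition padic_unit : pred Zp := fun x => x 1 != 0%N.

Lemma padic_unit_coprime x n : padic_unit x -> coprime (x n) (p ^ n).
Proof.
rewrite /padic_unit => ux; case: n => [|n]; first by rewrite coprimen1.
rewrite coprime_sym coprime_pexpl// prime_coprime//.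
by rewrite /dvdn -{2}(expn1 p) padic_le.
Qed.

Lemma padic_inv_res x n : padic_unit x ->
  (x n ^ (totient (p ^ n)).-1 * x n = 1 %[mod p ^ n])%N.
Proof.
move=> ux; rewrite -expnSr prednK ?totient_gt0 ?expn_gt0 ?p_gt0//.
by rewrite Euler_exp_totient// padic_unit_coprime.
Qed.

Fact padic_inv_subproof x : padic_unit x -> forall n,
  (x n.+1 ^ (totient (p ^ n.+1)).-1 = x n ^ (totient (p ^ n)).-1 %[mod p ^ n])%N.
Proof.
move=> ux n; set a := (x n.+1 ^ _)%N; set b := (x n ^ _)%N.
have ha : (a * x n = 1 %[mod p ^ n])%N.
  rewrite -modnMmr -padic_modS modnMmr.
  have := padic_inv_res n.+1 ux; rewrite -/a => /(congr1 (modn^~ (p ^ n)%N)).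
  by rewrite !modn_dvdm// dvdn_exp2l.
have hb : (b * x n = 1 %[mod p ^ n])%N by exact: padic_inv_res.
rewrite -[a]muln1 -modnMmr -hb modnMmr mulnCA -modnMmr ha.
by rewrite modnMmr muln1.
Qed.

Definition padic_inv x : Zp :=
  if pselect (padic_unit x) is left ux then padic_of (padic_inv_subproof ux)
  else x.

Fact padic_mulVx : {in padic_unit, left_inverse 1 padic_inv *%R}.
Proof.
move=> x ux; rewrite /padic_inv; case: pselect => // ux'.
by apply: padicP => n; rewrite padic_resM /= modnMml padic_inv_res.
Qed.
Fact padic_unitPl x y : y * x = 1 -> padic_unit x.
Proof.
move=> /(congr1 (fun z : Zp => z 1)); rewrite padic_resM padic_res1 expn1.
rewrite [RHS]modn_small ?prime_gt1// /padic_unit.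
by case: eqP => // ->; rewrite muln0 mod0n.
Qed.
Fact padic_inv_out : {in [predC padic_unit], padic_inv =1 id}.
Proof. by move=> x /negP nux; rewrite /padic_inv; case: pselect. Qed.
HB.instance Definition _ := GRing.ComNzRing_hasMulInverse.Build Zp
  padic_mulVx padic_unitPl padic_inv_out.

Lemma padic_unitE x : (x \is a GRing.unit) = (x 1 != 0%N). Proof. by []. Qed.

Fact padic_mulf_eq0 x y : x * y = 0 -> (x == 0) || (y == 0).
Proof.
move=> xy0; apply: contrapT => /negP; rewrite negb_or => /andP[x0 y0].
have ex z : z != 0 -> exists n, z n != 0%N.
  move=> /eqP z0; apply: contrapT => h; apply: z0; apply: padicP => n.
  rewrite padic_res0; apply/eqP; apply: contrapT => /negP zn.
  by apply: h; exists n.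
have [n xn] := ex _ x0; have [m ym] := ex _ y0.
move: (congr1 (fun z : Zp => z (n + m)%N) xy0); rewrite padic_res0 padic_resM.
move/eqP; rewrite -/(dvdn _ _).
have xN : ~~ (p ^ n %| x (n + m))%N by rewrite /dvdn padic_le// leq_addr.
have yN : ~~ (p ^ m %| y (n + m))%N by rewrite /dvdn padic_le// leq_addl.
have pos k (a : nat) : ~~ (p ^ k %| a)%N -> (0 < a)%N by case: a; rewrite ?dvdn0.
have [a0 b0] := (pos _ _ xN, pos _ _ yN).
move: xN yN; rewrite !pfactor_dvdn ?muln_gt0 ?a0 ?b0// lognM// -!ltnNge.
by move=> h1 h2; rewrite leqNgt -addSn leq_add// ltnW.
Qed.
HB.instance Definition _ :=
  GRing.ComUnitRing_isIntegral.Build Zp padic_mulf_eq0.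


Lemma padic_lift x y k :
  x 1 = y 1 -> (x ^+ (p ^ k)) k.+1 = (y ^+ (p ^ k)) k.+1.
Proof.
move=> exy; rewrite !padic_resX; apply: lift_modXX => //.
by move: exy; rewrite -!(@padic_le _ 1 k.+1)// expn1.
Qed.

(* The Teichmueller lift of a is the p-adic limit of the a^(p^n); it sends 0  *)
(* to 0, so this is also the extension of the character to all of F_p.        *)
Fact teichmuller_subproof (a : 'F_p) n :
  (a ^ (p ^ n.+1) = a ^ (p ^ n) %[mod p ^ n])%N.
Proof.
have := lift_modXX n p_pr (fermat_little a p_pr).
rewrite -expnM -expnS => /(congr1 (modn^~ (p ^ n)%N)).
by rewrite !modn_dvdm// dvdn_exp2l.
Qed.
Definition teichmuller (a : 'F_p) : Zp := padic_of (teichmuller_subproof a).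

Lemma teichmuller_resE (a : 'F_p) n :
  teichmuller a n = (a ^ (p ^ n) %% p ^ n)%N.
Proof. by []. Qed.

Lemma teichmuller_res1 (a : 'F_p) : teichmuller a 1 = a :> nat.
Proof.
rewrite /= expn1 fermat_little// modn_small//.
by have := ltn_ord a; rewrite [X in (_ < X)%N]Fp_cast.
Qed.

Lemma teichmuller0 : teichmuller 0 = 0.
Proof. by apply: padicP => n /=; rewrite exp0n ?expn_gt0 ?p_gt0. Qed.

Lemma teichmuller1 : teichmuller 1 = 1.
Proof.
by apply: padicP => n; rewrite padic_res1 /= exp1n.
Qed.

Lemma teichmullerM : {morph teichmuller : a b / a * b}.
Proof.
move=> a b; apply: padicP => n; rewrite padic_resM !teichmuller_resE modnMm -expnMn.
have -> : (a * b : 'F_p) = (a * b %% p)%N :> nat.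
  by rewrite -(val_Fp_nat p_pr); congr (val _); rewrite natrM !natr_Zp.
have : (a * b %% p = a * b %[mod p])%N by rewrite modn_mod.
move=> /(lift_modXX n p_pr) /(congr1 (modn^~ (p ^ n)%N)).
by rewrite !modn_dvdm// dvdn_exp2l.
Qed.

Definition morita_nat (m : nat) : Zp :=
  (-1) ^+ m * (\prod_(1 <= j < m | ~~ (p %| j)%N) j)%:R.

(* Morita's function at x is the limit of morita_nat m as the natural number  *)
(* m tends p-adically to x.                                                   *)
Definition is_padic_Gamma x y :=
  forall n, exists N, forall m, (m%:R : Zp) N = x N -> morita_nat m n = y n.

Definition padic_Gamma x : Zp := xget 0 [set y | is_padic_Gamma x y].

Section GammaLimit.
Hypothesis p_odd : odd p.

Let F j := if (p %| j)%N then 1%N else j.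
Let Q m q := (\prod_(m <= j < m + q) F j)%N.

Let morita_natE m : morita_nat m = (-1) ^+ m * (Q 0 m)%:R.
Proof.
rewrite /morita_nat; congr (_ * _%:R); rewrite /Q add0n.
case: m => [|m]; first by rewrite !big_geq.
rewrite [RHS]big_ltn// {1}/F dvdn0 mul1n big_mkcond; apply: eq_bigr => j _.
by rewrite /F; case: (p %| j)%N.
Qed.

Let F_mod k j c : (F (j + c * p ^ k.+1) = F j %[mod p ^ k.+1])%N.
Proof.
rewrite /F dvdn_addl ?dvdn_mull ?dvdn_exp//.
by case: ifP => // _; rewrite addnC modnMDl.
Qed.

Let Q_shift k m : (Q m (p ^ k.+1) = Q 0 (p ^ k.+1) %[mod p ^ k.+1])%N.
Proof.
have := F_mod k ^~ 1%N; have : (0 < p ^ k.+1)%N by rewrite expn_gt0 p_gt0.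
move: (p ^ k.+1)%N => q q_gt0 Fq; elim: m => // m <-.
have lt_mq : (m < m + q)%N by rewrite -addn1 leq_add2l.
have -> : Q m.+1 q = (\prod_(m.+1 <= j < m + q) F j * F (m + q))%N.
  by rewrite /Q addSn big_nat_recr.
have -> : Q m q = (F m * \prod_(m.+1 <= j < m + q) F j)%N.
  by rewrite /Q big_ltn.
by rewrite -modnMmr -[X in F (_ + X)]mul1n Fq modnMmr mulnC.
Qed.

Let Q_block k c : (Q 0 (c * p ^ k.+1) = Q 0 (p ^ k.+1) ^ c %[mod p ^ k.+1])%N.
Proof.
elim: c => [|c IH]; first by rewrite mul0n /Q big_geq.
rewrite /Q add0n (@big_cat_nat _ _ _ (c * p ^ k.+1)%N) ?leq_mul//=.
rewrite -modnMm mulSn [(p ^ _ + _)%N]addnC -/(Q _ _) Q_shift.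
by move: IH; rewrite {1}/Q add0n => ->; rewrite modnMm -expnSr.
Qed.

Let Q_wilson k : ((Q 0 (p ^ k.+1))%:R : Zp) 1 = (-1 : Zp) 1.
Proof.
have -> : ((Q 0 (p ^ k.+1))%:R : Zp) 1 = ((Q 0 p)%:R ^+ (p ^ k) : Zp) 1.
  rewrite -natrX !padic_res_nat expnSr.
  by have := Q_block 0 (p ^ k); rewrite expn1.
have -> : (-1 : Zp) 1 = ((-1) ^+ (p ^ k) : Zp) 1.
  by rewrite -signr_odd oddX p_odd orbT.
rewrite !padic_resX; congr (_ ^ _ %% _)%N.
have QE : Q 0 p = (p.-1)`!%N.
  rewrite /Q add0n big_ltn ?p_gt0// {1}/F dvdn0 mul1n fact_prod prednK ?p_gt0//.
  apply: eq_big_nat => j /andP[j0 jp].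
  by rewrite /F gtnNdvd.
have /esym W := Wilson (prime_gt1 p_pr); rewrite p_pr in W.
have : ((Q 0 p)%:R + 1 : Zp) 1 = 0%N.
  by rewrite natr1 QE padic_res_nat expn1; apply/eqP.
set z := (_%:R : Zp) => z1.
have -> : z = (z + 1) + -1 by rewrite addrK.
by rewrite padic_resD z1 add0n padic_mod.
Qed.

Let morita_nat_add m c n :
  morita_nat (m + c * p ^ n.*2.+1) n = morita_nat m n.
Proof.
elim: c => [|c IH]; first by rewrite addn0.
rewrite mulSnr addnA -IH; move: (m + _)%N => {IH}m.
case: n => [|n]; first by rewrite -[LHS]padic_mod -[RHS]padic_mod expn0 !modn1.
set N := n.+1.*2.
have QS a b : Q 0 (a + b) = (Q 0 a * Q a b)%N.
  by rewrite /Q !add0n (@big_cat_nat _ _ _ a) ?leq_addr.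
rewrite !morita_natE QS natrM exprD -!mulrA [in LHS]padic_resM.
rewrite [in RHS]padic_resM; congr (_ * _ %% _)%N.
rewrite mulrCA padic_resM.
suff -> : ((-1) ^+ (p ^ N.+1) * (Q m (p ^ N.+1))%:R : Zp) n.+1 = (1 : Zp) n.+1.
  by rewrite -padic_resM mulr1.
have -> : (-1 : Zp) ^+ (p ^ N.+1) = -1.
  by rewrite -signr_odd oddX p_odd orbT.
suff QN : ((Q m (p ^ N.+1))%:R : Zp) n.+1 = (-1 : Zp) n.+1.
  by rewrite padic_resM QN -padic_resM mulrNN mulr1.
rewrite padic_res_nat.
have le_nN : (n.+1 <= N.+1)%N by rewrite /N -addnn; rewrite -addnS leq_addr.
rewrite -(modn_dvdm _ (dvdn_exp2l p le_nN)) Q_shift modn_dvdm ?dvdn_exp2l//.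
have -> : (p ^ N.+1 = p ^ n.+2 * p ^ n.+1)%N.
  by rewrite -expnD; congr (_ ^ _)%N; rewrite /N -addnn addSn.
rewrite Q_block -padic_res_nat natrX.
have := padic_lift n.+2 (Q_wilson n).
move=> /(congr1 (modn^~ (p ^ n.+1)%N)); rewrite !padic_le ?(ltnW (leqnSn _))//.
by move=> ->; rewrite -signr_odd oddX p_odd orbT.
Qed.

Let morita_nat_congr m m' n :
  (m = m' %[mod p ^ n.*2.+1])%N -> morita_nat m n = morita_nat m' n.
Proof.
move=> e; rewrite (divn_eq m (p ^ n.*2.+1)) (divn_eq m' (p ^ n.*2.+1)) e.
by rewrite ![(_ * _ + _)%N]addnC !morita_nat_add.
Qed.

Lemma padic_Gamma_limit x : is_padic_Gamma x (padic_Gamma x).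
Proof.
suff [y hy] : exists y, is_padic_Gamma x y 
  by apply: (@xgetPex _ 0 (is_padic_Gamma x)); exists y.
pose f n := morita_nat (x n.*2.+1) n.
have fS n : (f n.+1 = f n %[mod p ^ n])%N.
  rewrite padic_mod {1}/f padic_le//; apply: morita_nat_congr.
  by rewrite padic_mod padic_le// doubleS !ltnS !leqW.
exists (padic_of fS) => n; exists n.*2.+1 => m; rewrite padic_res_nat => mx /=.
by rewrite padic_mod; apply: morita_nat_congr; rewrite padic_mod.
Qed.
End GammaLimit.

End PadicInt.

Notation padic_num p_pr := {fraction (padic_int p_pr)}.

Section Characters.
Variables (p : nat) (p_pr : prime p).
Local Notation Qp := (padic_num p_pr).
Implicit Types (A B : 'F_p -> Qp) (x : 'F_p).

Definition omega x : Qp := tofrac (teichmuller p_pr x).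

Definition quadchar x : Qp :=
  if x == 0 then 0 else if [exists y : 'F_p, y ^+ 2 == x] then 1 else -1.

Definition char_mul A B : 'F_p -> Qp := fun x => A x * B x.

(* The inverse (conjugate) character; it vanishes at 0 because 0^-1 = 0.      *)
Definition char_inv A : 'F_p -> Qp := fun x => (A x)^-1.

(* Every power, including the 0-th (the trivial character), vanishes at 0.    *)
Definition char_pow A (r : nat) : 'F_p -> Qp :=
  fun x => if x == 0 then 0 else A x ^+ r.

Definition jacobi_sum A B : Qp := \sum_(x : 'F_p) A x * B (1 - x).

Definition char_binom A B : Qp := B (-1) / p%:R * jacobi_sum A (char_inv B).

End Characters.

Definition frac_part (x : rat) : rat := x - (Num.floor x)%:~R.

Section HypergeometricG.
Variables (p : nat) (p_pr : prime p).
Local Notation Zp := (padic_int p_pr).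
Local Notation Qp := (padic_num p_pr).

(* ratr embeds the rationals with denominator prime to p into Z_p.            *)
Definition Gamma_rat (x : rat) : Qp := tofrac (padic_Gamma (ratr x : Zp)).

Definition nGn n (a b : n.-tuple rat) (t : 'F_p) : Qp :=
  - 1 / (p.-1)%:R *
  \sum_(0 <= j < p.-1)
    (-1) ^+ (j * n) * char_pow (char_inv (omega p_pr)) j t *
    \prod_(i < n)
      let ai := tnth a i in let bi := tnth b i in
      let u : rat := j%:R / (p.-1)%:R in
      (- p%:R) ^ (- Num.floor (frac_part ai - u)
                  - Num.floor (frac_part (- bi) + u)) *
      (Gamma_rat (frac_part (ai - u)) / Gamma_rat (frac_part ai)) *
      (Gamma_rat (frac_part (- bi + u)) / Gamma_rat (frac_part (- bi))).

Definition G22 (r : nat) (t : 'F_p) : Qp :=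
  let u : rat := r%:R / (p.-1)%:R in
  let v : rat := r%:R / (2 * p.-1)%N%:R in
  nGn [tuple u; - (1 / 2%:R) - u] [tuple - v; - v - 1 / 2%:R] t.

End HypergeometricG.

Definition affine_DIK (p : nat) (lambda : 'F_p) : {set 'F_p * 'F_p} :=
  [set P | P.2 ^+ 2 == P.1 ^+ 3 + 3%:R * lambda * (P.1 + 1) ^+ 2]%SET.

Definition card_DIK (p : nat) (lambda : 'F_p) : nat := #|affine_DIK lambda|.+1.

Definition ap_DIK (p : nat) (lambda : 'F_p) : int :=
  p%:Z + 1 - (card_DIK lambda)%:Z.

(* Main.v *)
From HB Require Import structures.
Require Import Defs.
From mathcomp Require Import all_boot all_order all_algebra cyclic fraction.
From mathcomp Require Import boolp.
From mathcomp Require Import ring zify.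

(* Up to the factor (-p)^m, a product of Gauss sums g(omega^-a) equals the    *)
(* corresponding product of values Gamma_p(a/(p-1)) (Gross-Koblitz).  Only a  *)
(* consequence free of Gauss sums is needed: k-fold Jacobi sums are quotients *)
(* of such products.  It is obtained from Dwork's series exp(T + T^p/p): at   *)
(* Teichmueller points x, y, z with x + y = z + p d one has                   *)
(* E(Tx) E(Ty) = E(Tz) exp(d (p T + T^p)), and the last factor is 1 modulo    *)
(* T^(p-1) + p, so that E behaves like an additive character.  The numbers    *)
(* Gamma_p(r/(p-1)) are read off the coefficients of E from Dwork's expansion *)
(* of Gamma_p at negative integers and a telescoping recurrence.              *)
(* After multiplication by the binomial coefficient, the j-th term of         *)
(* 2G2(r, 1) becomes, by the duplication and reflection formulas of Gamma_p,  *)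
(* a 4-fold Jacobi sum times omega(4)^j.  Orthogonality in r and j then       *)
(* leaves the solutions of x + y + z + w = 1, 4xy = z^2, 6 lambda yw = xz,    *)
(* which are parametrized by s = z/(2x); the point of the curve attached to   *)
(* s has abscissa 1/s.                                                        *)

Set Implicit Arguments.
Unset Strict Implicit.
Unset Printing Implicit Defensive.

Import Order.TTheory GRing.Theory Num.Theory.
Local Open Scope ring_scope.

(** * Truncated exponentials *)

(** The p-adic half of the argument shows that a k-fold Jacobi sum of powers of the inverse of omega
    is a quotient of values Gamma_p(a/(p-1)) times a power of -p ([jacobi_conv_gamma]). The reason
    is that one number, [dwork_sum], is at once the coordinate of a Gauss sum on pi^a and, up to a
    factor 1 - p, the value Gamma_p(a/(p-1)) ([gam_dwork_sum]).

    The other half reads this backwards. In the (r, j) term of the left-hand side, duplication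
    merges the Gamma factors with denominators 2(p-1) into one value and a power of omega(2). The
    binomial coefficient is a 2-fold Jacobi sum, which cancels denominators, and reflection moves
    the last one, at r, to a numerator at p-1-r. The result is a 4-fold Jacobi sum whose exponents
    add up to (p-1)/2 modulo p-1, and the powers of -p match ([summandE]).

    Orthogonality in j and r then imposes 4xy = z^2 and 6 lambda yw = xz on x + y + z + w = 1. On
    the conic, z = 2xs and y = xs^2, and the second equation becomes linear in x; what survives is
    the sum S of phi(s D(s)) over s != 0, with D = [curve_poly] ([quad_sumE], [charsumE]). The
    substitution of 1/s for the abscissa turns the cubic of the curve into s D(s) times a fourth
    power, so a_p = -phi(3 lambda) - S ([card_affine_DIK]). The sum over r omits r = 0; this
    contributes -phi(3 lambda) (p-2)/(p-1), which differs from the term -phi(3 lambda) of a_p by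
    exactly phi(3 lambda)/(p-1). *)

Section TruncatedExp.
Variables (F : fieldType).
Hypothesis natF_neq0 : forall m, m.+1%:R != 0 :> F.
Implicit Types (P Q D : {poly F}) (N : nat).

Definition eqT N P Q := forall i, (i < N)%N -> P`_i = Q`_i.

Lemma eqTM N P P' Q Q' : eqT N P P' -> eqT N Q Q' -> eqT N (P * Q) (P' * Q').
Proof.
move=> hP hQ i iN; rewrite !coefM; apply: eq_bigr => j _.
have ji : (j <= i)%N by rewrite -ltnS ltn_ord.
by rewrite hP ?hQ// (leq_ltn_trans _ iN)// leq_subr.
Qed.

(** In characteristic 0 the relation P' = D P determines the coefficients of P one after the other,
    so identities between exponentials follow by comparing logarithmic derivatives. Differentiation
    costs one coefficient, whence [N.-1]. *)
Lemma ode_unique N D P Q : P`_0 = Q`_0 ->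
  eqT N.-1 P^`() (D * P) -> eqT N.-1 Q^`() (D * Q) -> eqT N P Q.
Proof.
move=> e0 hP hQ i; elim/ltn_ind: i => -[//|i] IH iN.
have iN' : (i < N.-1)%N by lia.
have := hP _ iN'; have := hQ _ iN'; rewrite !coef_deriv !coefM => eQ eP.
have {eP}eQ : P`_i.+1 *+ i.+1 = Q`_i.+1 *+ i.+1.
  rewrite eP eQ; apply: eq_bigr => j _; congr (_ * _); apply: IH; lia.
by apply: (mulIf (natF_neq0 i)); rewrite !mulr_natr.
Qed.

Lemma ode_mul N D E P Q :
  eqT N P^`() (D * P) -> eqT N Q^`() (E * Q) ->
  eqT N (P * Q)^`() ((D + E) * (P * Q)).
Proof.
move=> hP hQ.
have -> : (D + E) * (P * Q) = D * P * Q + P * (E * Q) by ring.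
rewrite derivM => i iN; rewrite !coefD.
by congr (_ + _); apply: (@eqTM N).
Qed.

Definition texp N Q : {poly F} := \sum_(k < N) k`!%:R^-1 *: Q ^+ k.

Lemma factF_neq0 k : k`!%:R != 0 :> F.
Proof. by have := fact_gt0 k; case: k`! => // m _. Qed.

Lemma coef_expX_lt Q k i : Q`_0 = 0 -> (i < k)%N -> (Q ^+ k)`_i = 0.
Proof.
move=> Q0; elim: k i => // k IH i ik; rewrite exprS coefM big1// => j _.
case: (posnP j) => [->|j0]; first by rewrite Q0 mul0r.
rewrite IH ?mulr0//; have := ltn_ord j; lia.
Qed.

Lemma texp_coef0 N Q : Q`_0 = 0 -> (texp N.+1 Q)`_0 = 1.
Proof.
move=> Q0; rewrite /texp big_ord_recl coefD coefZ expr0 coef1 fact0 invr1 mulr1.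
rewrite coef_sum big1 ?addr0// => i _.
by rewrite coefZ coef_expX_lt ?mulr0.
Qed.

Lemma texp_ode N Q : Q`_0 = 0 -> eqT N.-1 (texp N Q)^`() (Q^`() * texp N Q).
Proof.
case: N => [|N] Q0 i //= iN.
have -> : (texp N.+1 Q)^`() = Q^`() * texp N Q.
  rewrite /texp raddf_sum big_ord_recl /= expr0 derivZ derivC scaler0 add0r mulr_sumr.
  apply: eq_bigr => k _; rewrite derivZ deriv_exp /= /bump /= add1n -scalerAr.
  rewrite factS natrM invfM -scaler_nat scalerA mulrAC mulVf ?natF_neq0//.
  by rewrite mul1r.
apply: (@eqTM N) => // {}i {}iN; rewrite /texp big_ord_recr /= coefD coefZ.
by rewrite (coef_expX_lt Q0 iN) mulr0 addr0.
Qed.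

End TruncatedExp.

(** * Powers of p in factorials and falling factorials *)

Definition pfree_fact (p n : nat) : nat :=
  (\prod_(1 <= j < n.+1 | ~~ (p %| j)) j)%N.

Lemma fact_pfree p n : prime p ->
  (n`! = p ^ (n %/ p) * (n %/ p)`! * pfree_fact p n)%N.
Proof.
move=> p_pr; have p_gt0 := prime_gt0 p_pr; elim: n => [|n IH].
  by rewrite div0n /pfree_fact big_geq.
rewrite factS IH /pfree_fact [in RHS]big_mkcond big_nat_recr//= -big_mkcond/=.
rewrite -/(pfree_fact p n) divnS//; case: (boolP (p %| n.+1)%N) => /= [dvd|ndvd].
  rewrite add1n factS expnS.
  have -> : n.+1 = ((n %/ p).+1 * p)%N.
    by rewrite -[LHS](divnK dvd) divnS// dvd.
  ring.
by rewrite add0n; ring.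
Qed.

Lemma pfree_fact_ndvd p n : prime p -> ~~ (p %| pfree_fact p n)%N.
Proof.
move=> p_pr; rewrite /pfree_fact; elim/big_rec: _ => [|j m hj hm].
  by rewrite dvdn1; case: eqP p_pr => // ->.
by rewrite Euclid_dvdM// negb_or hj.
Qed.

Lemma pfree_fact_gt0 p n : prime p -> (0 < pfree_fact p n)%N.
Proof.
move=> /(pfree_fact_ndvd n) ndvd; rewrite lt0n.
by apply: contraNneq ndvd => ->; rewrite dvdn0.
Qed.

(** With q = n %/ p and v the p-adic valuation, [fact_pfree] gives v(n!) = q + v(q!); by induction
    (p-1) v(n!) <= (p-1) q + q = p q <= n. *)
Lemma logn_fact_le p n : prime p -> (p.-1 * logn p n`! <= n)%N.
Proof.
move=> p_pr; have p_gt1 := prime_gt1 p_pr.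
elim/ltn_ind: n => n IH; case: (ltnP n p) => [np|pn].
  rewrite (fact_pfree n p_pr) divn_small// expn0 !mul1n.
  by have /negPf := pfree_fact_ndvd n p_pr; rewrite lognE => ->; rewrite !andbF muln0.
have h : (n %/ p < n)%N by rewrite ltn_Pdiv//; lia.
have := pfree_fact_ndvd n p_pr => ndvd.
have pf0 := pfree_fact_gt0 n p_pr.
rewrite (fact_pfree n p_pr) !lognM ?muln_gt0 ?expn_gt0 ?fact_gt0 ?(ltnW p_gt1)//.
rewrite pfactorK//.
have -> : logn p (pfree_fact p n) = 0%N.
  by rewrite lognE (negPf ndvd) !andbF.
have := IH _ h; have := leq_trunc_div n p; nia.
Qed.

Lemma fallfact_dvd p n r : (0 < r < p)%N -> (p %| (n * p + r).-1 ^_ p.-1)%N.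
Proof.
move=> /andP[r0 rp]; rewrite ffact_prod.
have rp' : (r.-1 < p.-1)%N by lia.
rewrite (bigD1 (Ordinal rp'))//= dvdn_mulr//.
have -> : ((n * p + r).-1 - r.-1 = n * p)%N by lia.
by rewrite dvdn_mull.
Qed.

Lemma fallfact_wilson p n : prime p -> (p %| ((n.+1 * p).-1 ^_ p.-1).+1)%N.
Proof.
move=> p_pr; have p_gt1 := prime_gt1 p_pr.
have /esym := Wilson p_gt1; rewrite p_pr /dvdn -addn1 -modnDml => /eqP W.
rewrite -addn1 -modnDml -[X in _ == X]W; apply/eqP; congr ((_ + _) %% _)%N.
rewrite -ffactnn !ffact_prod.
elim/big_ind2: _ => // [a b c d ab cd|i _]; first by rewrite -modnMm ab cd modnMm.
have -> : ((n.+1 * p).-1 - i = n * p + (p.-1 - i))%N by have := ltn_ord i; lia.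
by rewrite modnMDl.
Qed.

Lemma prime_gt3_odd p : prime p -> (3 < p)%N -> odd p.
Proof. by move=> p_pr p_gt3; case: (even_prime p_pr) => // e; rewrite e in p_gt3. Qed.

Lemma prime_gt3_pred p : prime p -> (3 < p)%N -> p.-1 = (p.-1./2).*2.
Proof.
move=> p_pr p_gt3; have := prime_gt3_odd p_pr p_gt3.
rewrite -{1}(prednK (prime_gt0 p_pr)) /= => /negPf oP.
by rewrite -[LHS]odd_double_half oP.
Qed.

(** * The coefficients of exp (T + T^p/p) *)

Section DworkCoef.
Variables (F : fieldType) (O : subringClosed F) (p : nat).
Hypothesis p_pr : prime p.
Hypothesis p_gt3 : (3 < p)%N.
Hypothesis natF_neq0 : forall m, m.+1%:R != 0 :> F.
Hypothesis O_invn : forall m, ~~ (p %| m)%N -> (m%:R : F)^-1 \in O.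
Implicit Types (x y : F) (n m k : nat).

Let p_gt0 : (0 < p)%N. Proof. exact: prime_gt0. Qed.

Lemma pF_neq0 : p%:R != 0 :> F.
Proof. by rewrite -(prednK p_gt0). Qed.

Lemma pFX_neq0 n : p%:R ^+ n != 0 :> F.
Proof. by rewrite expf_neq0// pF_neq0. Qed.

Lemma O_nat n : n%:R \in O.
Proof. by rewrite rpred_nat. Qed.

Definition dv n x := x / p%:R ^+ n \in O.

Lemma dvE n x : dv n x = (x / p%:R ^+ n \in O).
Proof. by []. Qed.

Lemma dvE0 x : dv 0 x = (x \in O).
Proof. by rewrite /dv expr0 divr1. Qed.

Lemma dv0 n : dv n 0.
Proof. by rewrite /dv mul0r rpred0. Qed.

Lemma dvD n x y : dv n x -> dv n y -> dv n (x + y).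
Proof. by rewrite /dv mulrDl; apply: rpredD. Qed.

Lemma dvN n x : dv n x -> dv n (- x).
Proof. by rewrite /dv mulNr rpredN. Qed.

Lemma dvB n x y : dv n x -> dv n y -> dv n (x - y).
Proof. by move=> hx hy; apply/dvD/dvN. Qed.

Lemma dv_sum n (I : Type) (r : seq I) (P : pred I) (f : I -> F) :
  (forall i, P i -> dv n (f i)) -> dv n (\sum_(i <- r | P i) f i).
Proof. by move=> h; elim/big_ind: _ => //; [exact: dv0 | exact: dvD]. Qed.

Lemma dvM n m x y : dv n x -> dv m y -> dv (n + m) (x * y).
Proof.
rewrite /dv exprD invfM => hx hy.
by rewrite mulrACA rpredM.
Qed.

Lemma dvMO n x y : x \in O -> dv n y -> dv n (x * y).
Proof. by rewrite -dvE0 => hx hy; rewrite -[n]add0n dvM. Qed.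

Lemma dvpM n k x : dv n x -> dv (k + n) (p%:R ^+ k * x).
Proof. by move=> hx; apply: dvM => //; rewrite /dv divff ?pFX_neq0 ?rpred1. Qed.

Lemma dvW n m x : (m <= n)%N -> dv n x -> dv m x.
Proof.
move=> /subnK <-; rewrite /dv exprD => h.
have -> : x / p%:R ^+ m = p%:R ^+ (n - m) * (x / (p%:R ^+ (n - m) * p%:R ^+ m)).
  by field; rewrite !pFX_neq0.
by rewrite rpredM// rpredX// O_nat.
Qed.

Lemma dv_nat n m : (p ^ n %| m)%N -> dv n m%:R.
Proof.
by move=> /dvdnP[k ->]; rewrite /dv natrM natrX mulfK ?pFX_neq0// O_nat.
Qed.

(** Truncation at [n.+1] is harmless, since the k-th power of T + T^p/p has no term below degree
    k. *)
Definition dwork_coef n : F :=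
  (texp n.+1 ('X + p%:R^-1 *: 'X^p))`_n.
Local Notation b := dwork_coef.

Lemma texp_stable N M (Q : {poly F}) i : Q`_0 = 0 ->
  (i < N)%N -> (i < M)%N -> (texp N Q)`_i = (texp M Q)`_i.
Proof.
move=> Q0; wlog: N M / (N <= M)%N => [W iN iM|NM iN iM].
  by case/orP: (leq_total N M) => h; [apply: W | symmetry; apply: W].
rewrite /texp -(subnKC NM) big_split_ord/= coefD -[LHS]addr0; congr (_ + _).
rewrite coef_sum big1// => j _; rewrite coefZ coef_expX_lt ?mulr0//=.
by rewrite ltn_addr.
Qed.

Let Q0 : ('X + p%:R^-1 *: 'X^p : {poly F})`_0 = 0.
Proof. by rewrite coefD coefX coefZ coefXn; case: p p_gt0 => // q _; rewrite mulr0 addr0. Qed.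

Lemma dwork_coef0 : b 0 = 1.
Proof. by rewrite /dwork_coef texp_coef0. Qed.

Lemma dwork_coef_rec n :
  n.+1%:R * b n.+1 = b n + (if (p <= n.+1)%N then b (n.+1 - p) else 0).
Proof.
have := texp_ode natF_neq0 (N := n.+2) Q0 (ltnSn n).
rewrite coef_deriv derivD derivX derivZ derivXn -scaler_nat scalerA.
rewrite mulVf ?pF_neq0// scale1r mulrDl mul1r coefD coefXnM.
move=> h; rewrite mulr_natl {1}/dwork_coef h; congr (_ + _).
  by rewrite /dwork_coef; apply: texp_stable.
have -> : (n < p.-1)%N = ~~ (p <= n.+1)%N by rewrite -ltnNge; lia.
rewrite -if_neg negbK; case: ifP => // pn; rewrite /dwork_coef.
have -> : (n - p.-1 = n.+1 - p)%N by lia.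
by apply: texp_stable => //; lia.
Qed.

Lemma dwork_scaled_rec n : (n.+1)`!%:R * b n.+1 = n`!%:R * b n +
  (if (p <= n.+1)%N then (n ^_ p.-1)%:R * ((n.+1 - p)`!%:R * b (n.+1 - p)) else 0).
Proof.
rewrite factS mulnC natrM -mulrA dwork_coef_rec mulrDr; congr (_ + _).
case: ifP => pn; last by rewrite mulr0.
rewrite mulrA -natrM; congr (_%:R * _).
have -> : (n.+1 - p = n - p.-1)%N by lia.
by rewrite ffact_fact//; lia.
Qed.

(* Blocks of length p are compared with the two preceding ones: inside a      *)
(* block the falling factorial is divisible by p, and at the end of a block   *)
(* it is -1 modulo p by Wilson's theorem.                                     *)
Lemma dv_dwork_scaled k r : (r < p)%N ->
  dv (uphalf k) ((k * p + r)`!%:R * b (k * p + r)).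
Proof.
pose t n := n`!%:R * b n; rewrite -/(t _).
suff H : (forall r, (r < p)%N -> dv (uphalf k) (t (k * p + r)%N)) /\
         (forall r, (r < p)%N -> dv (uphalf k.+1) (t (k * p + r)%N - t (k * p)%N)).
  by case: H => H _; exact: H.
elim/ltn_ind: k {r} => k IH.
have step s : (s < p)%N -> dv (uphalf k.+1) (t (k * p + s)%N - t (k * p)%N).
  elim: s => [|s IHs] sp; first by rewrite addn0 subrr dv0.
  rewrite addnS {1}/t dwork_scaled_rec -/(t _) -addrA addrC addrAC -addrA.
  apply: dvD; last by apply: IHs; lia.
  case: ifP => h; last exact: dv0.
  case: k IH h {IHs} => [|k] IH h; first by lia.
  have -> : ((k.+1 * p + s).+1 - p = k * p + s.+1)%N by lia.
  rewrite -/(t _) (_ : uphalf k.+2 = 1 + uphalf k)%N; last by lia.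
  apply: dvM; last by case: (IH k (ltnSn k)) => H _; apply: H.
  by apply: dv_nat; have := @fallfact_dvd p k.+1 s.+1; rewrite expn1 addnS; apply.
split => // r rp; rewrite -[t _](subrK (t (k * p)%N)); apply: dvD.
  by apply: dvW (step r rp); lia.
case: k IH step => [|k] IH step.
  by rewrite mul0n /t fact0 mul1r dwork_coef0 dvE0 rpred1.
have [H1 H2] := IH k (ltnSn k).
have e : (k.+1 * p = (k * p + p.-1).+1)%N by lia.
rewrite {1}/t e dwork_scaled_rec -/(t _) ifT; last by lia.
have -> : ((k * p + p.-1).+1 - p = k * p)%N by lia.
(* The first value of the new block is a difference inside the previous block plus [t (k * p)] times
   1 + a falling factorial, which p divides by Wilson's theorem. *)
rewrite -/(t _) -[t (_ + _)%N](subrK (t (k * p)%N)) -addrA.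
apply: dvD; first by apply: H2; lia.
rewrite -{1}[t (k * p)%N]mul1r -mulrDl nat1r.
have -> : (k * p + p.-1 = (k.+1 * p).-1)%N by lia.
apply: (@dvW (1 + uphalf k)); first by lia.
apply: dvM; first by apply: dv_nat; rewrite expn1 fallfact_wilson.
by have := H1 0%N p_gt0; rewrite addn0.
Qed.

Lemma O_invfact k : p%:R ^+ (k %/ p.-1) / k`!%:R \in O.
Proof.
set v := logn p k`!; have hv : (v <= k %/ p.-1)%N.
  by rewrite leq_divRL ?[(v * _)%N]mulnC ?logn_fact_le//; lia.
have [m ndvd e] := pfactor_coprime p_pr (fact_gt0 k).
rewrite e natrM natrX -/v invfM mulrCA -(subnK hv) exprD mulfK ?pFX_neq0//.
by rewrite rpredM ?rpredX ?O_nat ?O_invn// -prime_coprime.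
Qed.

(** Since n! is p^q q! times a unit of O, with q = n %/ p, the product p^q b(n) is n! b(n) / q! up
    to a unit. The numerator gains at least q/2 powers of p by [dv_dwork_scaled], and q! costs at
    most q/(p-1) <= q/4 of them, because p >= 5. *)
Lemma dv_dwork_coef n k : (n %/ p <= k)%N ->
  dv (n %/ p %/ 4) (p%:R ^+ k * b n).
Proof.
move=> hk; set q := (n %/ p)%N in hk *.
have := @dv_dwork_scaled q (n %% p) (ltn_pmod _ p_gt0); rewrite -divn_eq.
rewrite (fact_pfree n p_pr) -/q !natrM natrX => h.
have -> : p%:R ^+ k * b n = p%:R ^+ (k - q) * ((pfree_fact p n)%:R^-1 *
   (q`!%:R^-1 * (p%:R ^+ q * q`!%:R * (pfree_fact p n)%:R * b n))).
  rewrite -{1}(subnK hk) exprD; field.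
  rewrite (factF_neq0 natF_neq0)/=; have := pfree_fact_ndvd n p_pr.
  by case: (pfree_fact p n) => //; rewrite dvdn0.
apply: dvMO; first by rewrite rpredX ?O_nat.
apply: dvMO; first by rewrite O_invn ?pfree_fact_ndvd.
set y := p%:R ^+ q * q`!%:R * (pfree_fact p n)%:R * b n in h *.
rewrite /dv.
have -> : q`!%:R^-1 * y / p%:R ^+ (q %/ 4) =
  (p%:R ^+ (q %/ p.-1) / q`!%:R) * (y / p%:R ^+ (q %/ p.-1 + q %/ 4)).
  by rewrite exprD; field; rewrite !pFX_neq0 (factF_neq0 natF_neq0).
rewrite rpredM ?O_invfact//; apply: dvW h.
have p_ge5 : (4 <= p.-1)%N by case: p p_pr p_gt3 => [|[|[|[|[|]]]]].
have : (q %/ p.-1 <= q %/ 4)%N by apply: leq_div2l.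
by lia.
Qed.

End DworkCoef.

(** * Dwork's exponential at Teichmueller points, modulo T^(p-1) + p *)

Section DworkExp.
Variables (F : fieldType) (O : subringClosed F) (p : nat).
Hypothesis p_pr : prime p.
Hypothesis p_gt3 : (3 < p)%N.
Hypothesis natF_neq0 : forall m, m.+1%:R != 0 :> F.
Hypothesis O_invn : forall m, ~~ (p %| m)%N -> (m%:R : F)^-1 \in O.
Implicit Types (x y : F) (n m k N : nat) (P Q : {poly F}).

Let p_gt0 : (0 < p)%N. Proof. exact: prime_gt0. Qed.

Local Notation b := (dwork_coef F p).
Local Notation dv := (dv O p).

Definition dwork_exp N x : {poly F} := \poly_(i < N) (b i * x ^+ i).
Local Notation EN := dwork_exp.

Lemma dwork_exp_ode N x : eqT N.-1 (EN N x)^`()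
  ((x%:P + x ^+ p *: 'X^(p.-1)) * EN N x).
Proof.
move=> i iN; have iN1 : (i.+1 < N)%N by lia.
rewrite coef_deriv mulrDl coefD coefCM -scalerAl coefZ coefXnM !coef_poly iN1.
rewrite (ltnW iN1) -mulr_natl mulrA (dwork_coef_rec p_pr p_gt3 natF_neq0) mulrDl.
congr (_ + _); first by rewrite exprS mulrCA.
have -> : (i < p.-1)%N = ~~ (p <= i.+1)%N by rewrite -ltnNge; lia.
rewrite if_neg; case: ifP => pi; last by rewrite mul0r mulr0.
have -> : (i - p.-1 = i.+1 - p)%N by lia.
rewrite ifT; last by lia.
by rewrite mulrCA -exprD subnKC.
Qed.

(* T stands for a root pi of T^(p-1) + p; instead of adjoining it to F we work *)
(* modulo this polynomial, and weight the coefficient of T^i by p^(i/(p-1)).  *)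
Definition pi_poly : {poly F} := 'X^(p.-1) + p%:R%:P.
Local Notation M := pi_poly.

(** The condition x^p = x turns the logarithmic derivative x + x^p T^(p-1) of E(Tx) into x (1 +
    T^(p-1)), which is additive in x. The defect p d (1 + T^(p-1)) is the derivative of d T (T^(p-1)
    + p). *)
Lemma dwork_exp_mul N x y z d : x ^+ p = x -> y ^+ p = y -> z ^+ p = z ->
  x + y = z + p%:R * d ->
  eqT N (EN N x * EN N y) (EN N z * texp N (d *: ('X * M))).
Proof.
case: N => [|N] xp yp zp xyz; first by move=> i.
have L0 : (d *: ('X * M) : {poly F})`_0 = 0 by rewrite coefZ coefXM mulr0.
have EN0 u : (EN N.+1 u)`_0 = 1 by rewrite coef_poly /= (dwork_coef0 F p_pr) mulr1.
apply: (ode_unique natF_neq0); first by rewrite !coef0M !EN0 texp_coef0.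
  by apply: ode_mul; apply: dwork_exp_ode.
move=> i iN; rewrite (ode_mul (@dwork_exp_ode _ z) (texp_ode natF_neq0 L0))//.
congr (nth 0 (polyseq (_ * _)) i); rewrite xp yp zp.
have -> : (d *: ('X * M))^`() = (d * p%:R) *: ('X^(p.-1) + 1) :> {poly F}.
  rewrite derivZ derivM derivX /M derivD derivC addr0 derivXn mul1r.
  have -> : 'X * ('X^(p.-1.-1) *+ p.-1) = 'X^(p.-1) *+ p.-1 :> {poly F}.
    by rewrite mulrnAr -exprS prednK//; lia.
  rewrite -scalerA; congr (d *: _).
  rewrite addrAC -mulrS prednK// scalerDr scaler_nat; congr (_ + _).
  by rewrite alg_polyC.
rewrite -!mul_polyC polyCM.
have -> : x%:P + x%:P * 'X^(p.-1) + (y%:P + y%:P * 'X^(p.-1)) =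
   (x + y)%:P * ('X^(p.-1) + 1) :> {poly F} by rewrite polyCD; ring.
by rewrite xyz polyCD polyCM; ring.
Qed.

Definition lat n P := forall i, dv n (p%:R ^+ (i %/ p.-1) * P`_i).

(* Unlike lat, slow asks for a divisibility that grows linearly with i, so    *)
(* that truncation at a large degree costs only a large power of p.           *)
Definition slow s P :=
  forall i, dv (i %/ (p * 4)) (p%:R ^+ (i %/ p.-1 + s) * P`_i).

Lemma latD n P Q : lat n P -> lat n Q -> lat n (P + Q).
Proof. by move=> hP hQ i; rewrite coefD mulrDr; apply: dvD. Qed.

Lemma leq_divD a c d : (a %/ d + c %/ d <= (a + c) %/ d)%N.
Proof.
case: d => [|d]; first by rewrite !divn0.
by rewrite leq_divRL// mulnDl leq_add// leq_trunc_div.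
Qed.

Lemma latM n m P Q : lat n P -> lat m Q -> lat (n + m) (P * Q).
Proof.
move=> hP hQ i; rewrite coefM mulr_sumr; apply: dv_sum => j _.
have ji : (j <= i)%N by rewrite -ltnS ltn_ord.
have le := leq_divD j (i - j) p.-1; rewrite subnKC// in le.
rewrite -(subnK le) !exprD.
rewrite [X in dv _ X](_ : _ = p%:R ^+ (i %/ p.-1 - (j %/ p.-1 + (i - j) %/ p.-1)) *
  ((p%:R ^+ (j %/ p.-1) * P`_j) * (p%:R ^+ ((i - j) %/ p.-1) * Q`_(i - j)))).
  by apply: dvMO; [rewrite rpredX ?O_nat | apply: dvM].
by ring.
Qed.

Lemma lat_exp n P k : lat n P -> lat (k * n) (P ^+ k).
Proof.
move=> hP; elim: k => [|k IH]; last by rewrite exprS mulSn; apply: latM.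
move=> i; rewrite expr0 coef1; case: eqP => [->|_]; last by rewrite mulr0; apply: dv0.
by rewrite div0n mulr1 dvE0 rpred1.
Qed.

(** Splitting i = j + (i - j) can lower the sum of the quotients by [p * 4] by one; the additional
    factor p in [(s + t).+1] compensates. *)
Lemma slowM s t P Q : slow s P -> slow t Q -> slow (s + t).+1 (P * Q).
Proof.
move=> hP hQ i; rewrite coefM mulr_sumr; apply: dv_sum => j _.
have ji : (j <= i)%N by rewrite -ltnS ltn_ord.
have le := leq_divD j (i - j) p.-1; rewrite subnKC// in le.
rewrite -(subnK le).
rewrite [X in dv _ X](_ : _ = p%:R ^+ (i %/ p.-1 - (j %/ p.-1 + (i - j) %/ p.-1)) *
  (p%:R ^+ 1 * ((p%:R ^+ (j %/ p.-1 + s) * P`_j) *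
    (p%:R ^+ ((i - j) %/ p.-1 + t) * Q`_(i - j))))).
  apply: dvMO; first by rewrite rpredX ?O_nat.
  apply: (@dvW _ _ p p_pr natF_neq0 (1 + (j %/ (p * 4) + (i - j) %/ (p * 4)))) => //.
    have := divnD j (i - j) (_ : 0 < p * 4)%N; rewrite subnKC// => ->; last by lia.
    by case: (p * 4 <= _ + _)%N; lia.
  by apply: dvpM => //; apply: dvM; [apply: hP | apply: hQ].
by rewrite !exprD exprS !exprD; ring.
Qed.

Lemma slow_dwork_exp N x : x \in O -> slow 0 (EN N x).
Proof.
move=> xO i; rewrite coef_poly addn0; case: ifP => _; last by rewrite mulr0; apply: dv0.
rewrite mulrA mulrC; apply: dvMO; first by rewrite rpredX.
by rewrite divnMA; apply: dv_dwork_coef => //; apply: leq_div2l; lia.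
Qed.

Lemma lat_dwork_exp N x : x \in O -> lat 0 (EN N x).
Proof. by move=> xO i; have := slow_dwork_exp N xO i; rewrite addn0; apply: (dvW p_pr natF_neq0). Qed.

Lemma lat_pi_poly : lat 1 M.
Proof.
move=> i; rewrite coefD coefXn coefC mulrDr; apply: dvD.
  case: eqP => [->|_]; last by rewrite mulr0; apply: dv0.
  have p1 : (0 < p.-1)%N by lia.
  by rewrite divnn p1 mulr1; apply: dv_nat.
case: eqP => [->|_]; last by rewrite mulr0; apply: dv0.
by rewrite div0n mul1r; apply: dv_nat.
Qed.

Lemma size_pi_poly : size M = p.
Proof.
have p1 : (0 < p.-1)%N by lia.
by rewrite size_polyDl size_polyXn ?prednK// size_polyC; case: eqP => //=; lia.
Qed.

(** The k-th summand is supported in degrees k to k p, so T^i only sees k >= i/p. There M^k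
    contributes p^k ([lat_exp]), and the denominator k! is paid for by the weight of T^k
    ([O_invfact]). *)
Lemma slow_texp N d : d \in O -> slow 0 (texp N (d *: ('X * M))).
Proof.
move=> dO i; rewrite /texp coef_sum mulr_sumr; apply: dv_sum => k _.
rewrite exprZn coefZ coefZ exprMn coefXnM addn0 mulrCA.
case: ifP => [|/negbT]; first by rewrite !mulr0 => _; apply: dv0.
rewrite -leqNgt => ki.
have hs : (size (M ^+ k) <= (k * p.-1).+1)%N.
  by have := size_poly_exp_leq M k; rewrite size_pi_poly mulnC.
case: (ltnP (k * p.-1) (i - k)) => h.
  by rewrite nth_default ?mulr0 ?dv0//; apply: leq_trans hs _; lia.
have le : (i %/ (p * 4) <= k)%N.
  rewrite -(leq_pmul2r (_ : 0 < p * 4)%N); last by lia.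
  apply: leq_trans (leq_trunc_div _ _) _; nia.
apply: (dvW p_pr natF_neq0 le).
have e := leq_divD k (i - k) p.-1; rewrite subnKC// in e.
have L := @lat_exp 1 M k lat_pi_poly (i - k)%N; rewrite muln1 in L.
rewrite -(subnK e) !exprD.
set u := (p%:R ^+ (i %/ _ - _)); set v := p%:R ^+ (k %/ _).
rewrite [X in dv _ X](_ : _ = (u * d ^+ k * (v / k`!%:R)) *
   (p%:R ^+ ((i - k) %/ p.-1) * (M ^+ k)`_(i - k))); last by ring.
apply: dvMO => //; rewrite rpredM ?(O_invfact p_pr p_gt3)//.
by rewrite rpredM ?rpredX ?O_nat.
Qed.

(** Congruence of P(pi) and Q(pi) modulo p^n for a root pi of M. *)
Definition pi_cong n P Q := exists A B, P - Q = A + M * B /\ lat n A.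

Lemma pi_cong_refl n P : pi_cong n P P.
Proof.
by exists 0, 0; split; [ring | move=> i; rewrite coef0 mulr0; apply: dv0].
Qed.

Lemma pi_cong_trans n P Q R : pi_cong n P Q -> pi_cong n Q R -> pi_cong n P R.
Proof.
move=> [A [B [e h]]] [A' [B' [e' h']]]; exists (A + A'), (B + B').
by split; [rewrite -(subrKA Q) e e'; ring | apply: latD].
Qed.

Lemma pi_congMl n P Q R : lat 0 R -> pi_cong n P Q -> pi_cong n (R * P) (R * Q).
Proof.
move=> hR [A [B [e h]]]; exists (R * A), (R * B).
by split; [rewrite -mulrBr e; ring | rewrite -[n]add0n; apply: latM].
Qed.

Lemma pi_congZ n P Q c : c \in O -> pi_cong n P Q -> pi_cong n (c *: P) (c *: Q).
Proof.
move=> cO [A [B [e h]]]; exists (c *: A), (c *: B); split.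
  by rewrite -scalerBr e scalerDr scalerAr.
by move=> i; rewrite coefZ mulrCA; apply: dvMO.
Qed.

Lemma pi_cong_sum n (I : Type) (r : seq I) (S : pred I) (f g : I -> {poly F}) :
  (forall i, S i -> pi_cong n (f i) (g i)) ->
  pi_cong n (\sum_(i <- r | S i) f i) (\sum_(i <- r | S i) g i).
Proof.
move=> h; elim/big_ind2: _ => //; first exact: pi_cong_refl.
move=> P P' Q Q' [A [B [e hA]]] [A' [B' [e' hA']]]; exists (A + A'), (B + B').
by split; [rewrite opprD addrACA e e'; ring | apply: latD].
Qed.

(** E(Tx) E(Ty) and E(Tz) exp(d T M) agree below degree N; from N on, slowness makes both divisible
    by p^(n+1), of which [slow 1] loses one power. The truncated exponential of d T M is 1 modulo
    M. *)
Lemma pi_cong_dwork_exp n N x y z d : (p * 4 * n.+1 <= N)%N ->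
  [/\ x \in O, y \in O, z \in O & d \in O] ->
  [/\ x ^+ p = x, y ^+ p = y & z ^+ p = z] ->
  x + y = z + p%:R * d ->
  pi_cong n (EN N x * EN N y) (EN N z).
Proof.
move=> nN [xO yO zO dO] [xp yp zp] xyz.
set L := d *: ('X * M).
have [B hB] : exists B, EN N z * texp N L - EN N z = M * B.
  have [B hB] : exists B, texp N L = 1 + M * B.
    rewrite /texp; case: N nN {xO yO zO} => [|N] hN; first by nia.
    rewrite big_ord_recl fact0 invr1 scale1r expr0.
    exists (\sum_(i < N) (i.+1)`!%:R^-1 *: (L ^+ i * (d *: 'X))).
    congr (_ + _); rewrite mulr_sumr; apply: eq_bigr => i _.
    rewrite -scalerAr /= /bump/= add1n exprS; congr (_ *: _).
    by rewrite /L -!scalerAl -!scalerAr; congr (_ *: _); ring.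
  by exists (EN N z * B); rewrite hB; ring.
exists (EN N x * EN N y - EN N z * texp N L), B; split.
  by rewrite -hB; ring.
have hP : slow 1 (EN N x * EN N y) by apply: (@slowM 0 0); apply: slow_dwork_exp.
have hQ : slow 1 (EN N z * texp N L).
  by apply: (@slowM 0 0); [apply: slow_dwork_exp | apply: slow_texp].
move=> i; rewrite coefB; case: (ltnP i N) => iN.
  by rewrite (dwork_exp_mul xp yp zp xyz)// subrr mulr0; apply: dv0.
have := dvB (hP i) (hQ i); rewrite -mulrBr exprD expr1 => h.
have {}h : dv n.+1 (p%:R ^+ (i %/ p.-1) * p%:R *
   ((EN N x * EN N y)`_i - (EN N z * texp N L)`_i)).
  apply: (dvW p_pr natF_neq0) h => //.
  by rewrite leq_divRL ?muln_gt0 ?p_gt0// mulnC; apply: leq_trans nN iN.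
move: h; rewrite !dvE exprS.
set u := (_ - _); set v := p%:R ^+ _; set w := p%:R ^+ n.
have pF := pF_neq0 p_pr natF_neq0; have wF : w != 0 := pFX_neq0 p_pr natF_neq0 n.
suff -> : v * p%:R * u / (p%:R * w) = v * u / w by [].
by field; rewrite pF wF.
Qed.

End DworkExp.

(** * Gauss sums and Jacobi sums *)

Section Gauss.
Variables (F : fieldType) (O : subringClosed F) (p : nat).
Hypothesis p_pr : prime p.
Hypothesis p_gt3 : (3 < p)%N.
Hypothesis natF_neq0 : forall m, m.+1%:R != 0 :> F.
Hypothesis O_invn : forall m, ~~ (p %| m)%N -> (m%:R : F)^-1 \in O.
Implicit Types (x y : F) (n m k N a c : nat) (P Q : {poly F}) (l : seq nat).
Implicit Types (u v z : 'F_p).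

Variable tau : 'F_p -> F.
Hypothesis tau0 : tau 0 = 0.
Hypothesis tau1 : tau 1 = 1.
Hypothesis tauM : {morph tau : u v / u * v}.
Hypothesis tauO : forall u, tau u \in O.
Hypothesis tauD : forall u v, dv O p 1 (tau u + tau v - tau (u + v)).
Hypothesis tau_inj1 : forall u, tau u = 1 -> u = 1.

Let p_gt0 : (0 < p)%N. Proof. exact: prime_gt0. Qed.
Let p1_gt0 : (0 < p.-1)%N. Proof. by lia. Qed.

Local Notation b := (dwork_coef F p).
Local Notation dv := (dv O p).
Local Notation EN := (dwork_exp p).
Local Notation M := (pi_poly F p).
Local Notation cong := (pi_cong O p).
Local Notation lat := (lat O p).

(* The coordinate of P(pi) on pi^c in the basis 1, pi, ..., pi^(p-2). *)
Definition pi_coord c P : F :=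
  \sum_(i < size P | (i %% p.-1 == c)%N) (- p%:R) ^+ (i %/ p.-1) * P`_i.

Lemma pi_coordE n c P : (size P <= n)%N ->
  pi_coord c P = \sum_(i < n | (i %% p.-1 == c)%N) (- p%:R) ^+ (i %/ p.-1) * P`_i.
Proof.
move=> /subnKC <-; rewrite big_split_ord /= [X in _ = _ + X]big1 ?addr0// => i _.
by rewrite nth_default ?mulr0// leq_addr.
Qed.

Lemma pi_coordD c P Q : pi_coord c (P + Q) = pi_coord c P + pi_coord c Q.
Proof.
set n := maxn (size P) (size Q).
rewrite !(@pi_coordE n) ?leq_maxl ?leq_maxr// ?size_polyD//.
by rewrite -big_split; apply: eq_bigr => i _; rewrite coefD mulrDr.
Qed.

Lemma pi_coordZ c d P : pi_coord c (d *: P) = d * pi_coord c P.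
Proof.
rewrite (@pi_coordE (size P)) ?size_scale_leq// mulr_sumr.
by apply: eq_bigr => i _; rewrite coefZ mulrCA.
Qed.

Lemma pi_coord0 c : pi_coord c 0 = 0.
Proof. by rewrite -(scale0r 0) pi_coordZ mul0r. Qed.

Lemma pi_coord_sum c (I : Type) (r : seq I) (S : pred I) (f : I -> {poly F}) :
  pi_coord c (\sum_(i <- r | S i) f i) = \sum_(i <- r | S i) pi_coord c (f i).
Proof. exact: (big_morph _ (pi_coordD c) (pi_coord0 c)). Qed.

Lemma pi_coordXn c k :
  pi_coord c 'X^k = if (k %% p.-1 == c)%N then (- p%:R) ^+ (k %/ p.-1) else 0.
Proof.
rewrite (@pi_coordE k.+1) ?size_polyXn// big_mkcond big_ord_recr/= big1 ?add0r.
  by rewrite coefXn eqxx mulr1.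
by move=> i _; rewrite coefXn (ltn_eqF (ltn_ord i)) mulr0 if_same.
Qed.

Lemma pi_coord_pi_poly c P : pi_coord c (M * P) = 0.
Proof.
rewrite -[P]coefK poly_def mulr_sumr pi_coord_sum big1// => i _.
rewrite -scalerAr pi_coordZ mulrDl -exprD pi_coordD mul_polyC pi_coordZ !pi_coordXn.
rewrite modnDl divnDl// divnn p1_gt0 add1n.
by case: ifP => _; rewrite ?exprS ?mulNr ?mulr0 ?addNr ?addr0 ?mulr0.
Qed.

Lemma dv_sign n k x : dv n (p%:R ^+ k * x) -> dv n ((- p%:R) ^+ k * x).
Proof. by rewrite exprNn -mulrA => h; apply: dvMO => //; rewrite rpredX ?rpredN ?rpred1. Qed.

Lemma dv_pi_coord n c P Q : cong n P Q -> dv n (pi_coord c P - pi_coord c Q).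
Proof.
move=> [A [B [e hA]]].
have -> : pi_coord c P - pi_coord c Q = pi_coord c (P - Q).
  by rewrite -[- Q]scaleN1r pi_coordD pi_coordZ mulN1r.
rewrite e pi_coordD pi_coord_pi_poly addr0.
by apply: dv_sum => i _; apply: dv_sign; apply: hA.
Qed.

Lemma latXn k : lat 0 'X^k.
Proof. by move=> i; rewrite dvE0 coefXn rpredM ?rpredX ?rpred_nat. Qed.

Lemma latZ n d P : d \in O -> lat n P -> lat n (d *: P).
Proof. by move=> dO hP i; rewrite coefZ mulrCA; apply: dvMO. Qed.

Lemma lat_sum n (I : Type) (r : seq I) (S : pred I) (f : I -> {poly F}) :
  (forall i, lat n (f i)) -> lat n (\sum_(i <- r | S i) f i).
Proof.
move=> h; elim/big_ind: _ => //; last exact: latD.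
by move=> i; rewrite coef0 mulr0; apply: dv0.
Qed.

Lemma pi_congM n P P' Q Q' : lat 0 P -> lat 0 Q' ->
  cong n P P' -> cong n Q Q' -> cong n (P * Q) (P' * Q').
Proof.
move=> hP hQ' cP cQ; apply: (@pi_cong_trans _ _ _ _ _ (P * Q')).
  exact: pi_congMl.
by rewrite ![_ * Q']mulrC; apply: pi_congMl.
Qed.

Lemma pi_cong_sym n P Q : cong n P Q -> cong n Q P.
Proof.
move=> [A [B [e hA]]]; exists (- A), (- B); split.
  by rewrite -opprB e; ring.
by move=> i; rewrite coefN mulrN; apply: dvN.
Qed.

Lemma pi_red_Xn k :
  exists B, 'X^k - (- p%:R) ^+ (k %/ p.-1) *: 'X^(k %% p.-1) = M * B.
Proof.
rewrite {1}(divn_eq k p.-1); move: (k %/ _)%N (k %% _)%N => q r.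
(* The factorization of a^q - b^q by a - b, with a = T^(p-1) and b = -p. *)
exists ('X^r * \sum_(i < q) 'X^(p.-1) ^+ (q.-1 - i) * (- p%:R%:P) ^+ i).
have := subrXX 'X^(p.-1) (- p%:R%:P : {poly F}) q; rewrite opprK => key.
rewrite mulrCA -[X in _ * X]key exprD mulnC exprM -mul_polyC polyC_exp polyCN.
by ring.
Qed.

Lemma tau_neq0 u : u != 0 -> tau u != 0.
Proof.
move=> u0; apply/eqP => e; have := tauM u u^-1.
by rewrite divff// tau1 e mul0r; apply/eqP; rewrite oner_eq0.
Qed.

Lemma tauX u k : tau (u ^+ k) = tau u ^+ k.
Proof. by elim: k => [|k IH]; rewrite ?expr0// !exprS tauM IH. Qed.

Lemma tauV u : tau u^-1 = (tau u)^-1.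
Proof.
have [->|u0] := eqVneq u 0; first by rewrite invr0 tau0 invr0.
by apply: (mulfI (tau_neq0 u0)); rewrite -tauM !divff ?tau1// tau_neq0.
Qed.

Lemma expFp u : u ^+ p = u.
Proof.
rewrite -[u]natr_Zp -natrX; apply: val_inj; rewrite /= !val_Fp_nat//.
exact: fermat_little.
Qed.

Lemma tau_p u : tau u ^+ p = tau u.
Proof. by rewrite -tauX expFp. Qed.

Lemma expFp_pred u : u != 0 -> u ^+ p.-1 = 1.
Proof.
move=> u0; apply: (mulfI u0); rewrite -exprS prednK// expFp mulr1//.
Qed.

Lemma tau_mod u k : u != 0 -> tau u ^+ k = tau u ^+ (k %% p.-1).
Proof.
move=> u0; rewrite {1}(divn_eq k p.-1) exprD mulnC exprM -tauX expFp_pred//.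
by rewrite tau1 expr1n mul1r.
Qed.

(** Otherwise X^r - 1, with r = k %% (p-1) positive and below p-1, would have p-1 roots. *)
Lemma exists_exp_neq1 k : ~~ (p.-1 %| k)%N -> exists2 u : 'F_p, u != 0 & u ^+ k != 1.
Proof.
move=> ndvd; set r := (k %% p.-1)%N.
have r0 : (0 < r)%N by rewrite lt0n.
have rp : (r < p.-1)%N by rewrite ltn_mod.
suff [u u0 ur] : exists2 u : 'F_p, u != 0 & u ^+ r != 1.
  exists u => //; rewrite {1}(divn_eq k p.-1) exprD mulnC exprM expFp_pred//.
  by rewrite expr1n mul1r.
case: (pickP [pred u : 'F_p | (u != 0) && (u ^+ r != 1)]) => [u /andP[]|none].
  by exists u.
pose s := [seq u <- enum 'F_p | u != 0].
have hs : all (root ('X^r - 1)) s.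
  apply/allP => u; rewrite mem_filter => /andP[u0 _].
  by have := none u; rewrite /= u0 rootE !hornerE subr_eq0 => /negbFE.
have us : uniq s by rewrite filter_uniq// enum_uniq.
have := max_poly_roots (monic_neq0 (monicXnsubC 1 r0)) hs us.
rewrite size_XnsubC// size_filter -sum1_count big_enum_cond/= sum1_card.
rewrite (eq_card (B := predC1 (0 : 'F_p))); last by move=> u; rewrite !inE.
by rewrite cardC1 card_Fp//; lia.
Qed.

Lemma tau_orth k : \sum_(u | u != 0) tau u ^+ k =
  if (p.-1 %| k)%N then p.-1%:R else 0.
Proof.
case: ifP => [/dvdnP[q ->]|/negbT ndvd].
  rewrite (eq_bigr (fun=> 1)) => [|u u0]; last first.
    by rewrite mulnC exprM -tauX expFp_pred// tau1 expr1n.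
  rewrite sumr_const; congr (_ *+ _).
  by rewrite (eq_card (B := predC1 (0 : 'F_p))) ?cardC1 ?card_Fp// => u; rewrite !inE.
have [v v0 vk] := exists_exp_neq1 ndvd.
set s := \sum_(_ | _) _; suff : (tau v ^+ k - 1) * s = 0.
  move/eqP; rewrite mulf_eq0 subr_eq0 -tauX => /orP[/eqP/tau_inj1/eqP|/eqP//].
  by rewrite (negPf vk).
rewrite mulrBl mul1r mulr_sumr; apply/eqP; rewrite subr_eq0; apply/eqP.
rewrite [RHS](reindex_inj (mulfI v0))/=; apply: eq_big => [u|u _].
  by rewrite mulf_eq0 (negPf v0).
by rewrite tauM exprMn.
Qed.

(* This is omega^(-a) when tau is the Teichmueller character. *)
Definition tchar a u : F := if u == 0 then 0 else (tau u)^-1 ^+ a.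

Lemma tchar_def a u : tchar a u = if u == 0 then 0 else (tau u)^-1 ^+ a.
Proof. by []. Qed.

(* The sum of omega^(-a_1)(x_1) ... omega^(-a_k)(x_k) over x_1 + ... + x_k = z; *)
(* at z = 1 this is the k-fold Jacobi sum.                                    *)
Fixpoint jacobi_conv l z : F :=
  if l is a :: l' then \sum_u tchar a u * jacobi_conv l' (z - u)
  else (z == 0)%:R.

Lemma tcharM a u v : tchar a (u * v) = tchar a u * tchar a v.
Proof.
rewrite /tchar mulf_eq0; case: eqP => /= _; first by rewrite mul0r.
by case: eqP => _; rewrite ?mulr0// tauM invfM exprMn.
Qed.

Lemma tcharO a u : tchar a u \in O.
Proof. by rewrite /tchar; case: eqP; rewrite ?rpred0// -tauV rpredX. Qed.

Lemma jacobi_convO l z : jacobi_conv l z \in O.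
Proof.
elim: l z => [|a l IH] z /=; first by rewrite rpred_nat.
by rewrite rpred_sum// => u _; rewrite rpredM ?tcharO.
Qed.

Lemma jacobi_conv_scale l v z : v != 0 ->
  jacobi_conv l (v * z) = tchar (sumn l) v * jacobi_conv l z.
Proof.
move=> v0; elim: l z => [|a l IH] z /=.
  by rewrite mulf_eq0 /tchar (negPf v0) expr0 mul1r.
rewrite (reindex_inj (mulfI v0))/= mulr_sumr; apply: eq_bigr => u _.
rewrite -mulrBr IH tcharM !mulrA; congr (_ * _).
by rewrite /tchar (negPf v0) exprD; ring.
Qed.

(** The Gauss sum of [tchar a], with E(T tau(u)) in the role of an additive character of F_p. *)
Definition gauss_poly N a : {poly F} := \sum_u tchar a u *: EN N (tau u).

Lemma lat_gauss_poly N a : lat 0 (gauss_poly N a).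
Proof.
by apply: lat_sum => u; apply: latZ; [exact: tcharO | exact: lat_dwork_exp].
Qed.

Lemma prod_gauss_poly n N l : (p * 4 * n.+1 <= N)%N ->
  cong n (\prod_(a <- l) gauss_poly N a)
    (\sum_z jacobi_conv l z *: EN N (tau z)).
Proof.
move=> nN; elim: l => [|a l IH].
  rewrite big_nil (bigD1 0)//= ?eqxx scale1r big1 => [|z /negPf->]; last by rewrite scale0r.
  rewrite addr0 tau0 (_ : dwork_exp _ _ _ = 1); first exact: pi_cong_refl.
  apply/polyP => i; rewrite coef_poly coef1.
  case: i => [|i]; last by rewrite expr0n mulr0 if_same.
  by rewrite ifT ?expr0 ?mulr1 ?dwork_coef0//; nia.
rewrite big_cons /=; apply: (@pi_cong_trans _ _ _ _ _
    (gauss_poly N a * \sum_z jacobi_conv l z *: EN N (tau z))).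
  by apply: pi_congMl => //; apply: lat_gauss_poly.
have -> : \sum_z (\sum_u tchar a u * jacobi_conv l (z - u)) *: EN N (tau z) =
    \sum_u \sum_v (tchar a u * jacobi_conv l v) *: EN N (tau (u + v)).
  rewrite (eq_bigr _ (fun z _ => scaler_suml _ _ _ _)) exchange_big.
  apply: eq_bigr => u _; rewrite (reindex_inj (addrI u))/=.
  by apply: eq_bigr => v _; rewrite [u + v]addrC addrK [v + u]addrC.
rewrite /gauss_poly mulr_suml; apply: pi_cong_sum => u _.
rewrite mulr_sumr; apply: pi_cong_sum => v _.
rewrite -scalerAl -scalerAr scalerA.
apply: pi_congZ; first by rewrite rpredM ?tcharO ?jacobi_convO.
have h := tauD u v; rewrite dvE expr1 in h.
apply: (pi_cong_dwork_exp p_pr p_gt3 natF_neq0 O_invn nN 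
  (d := (tau u + tau v - tau (u + v)) / p%:R)).
- by split=> //; apply: tauO.
- by split; apply: tau_p.
by rewrite mulrC divfK ?(pF_neq0 p_pr natF_neq0)//; ring.
Qed.

(** For a < p-1, the coordinate on pi^a of E(pi), truncated at degree N. *)
Definition dwork_sum N a : F :=
  \sum_(i < N | (i %% p.-1 == a)%N) (- p%:R) ^+ (i %/ p.-1) * b i.

(** Orthogonality of the powers of [tau] keeps from E only the degrees congruent to a modulo p-1,
    and each such T^i reduces to a power of -p times T^a. *)
Lemma gauss_poly_cong n N a : (a < p.-1)%N ->
  cong n (gauss_poly N a) ((p.-1%:R * dwork_sum N a) *: 'X^a).
Proof.
move=> ap.
have -> : gauss_poly N a = \sum_(i < N | (i %% p.-1 == a)%N) (p.-1%:R * b i) *: 'X^i.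
  rewrite /gauss_poly; under eq_bigr do rewrite /dwork_exp poly_def scaler_sumr.
  rewrite exchange_big/= [RHS]big_mkcond; apply: eq_bigr => i _.
  under eq_bigr do rewrite scalerA; rewrite -scaler_suml.
  have -> : \sum_u tchar a u * (b i * tau u ^+ i) =
      b i * \sum_(u | u != 0) tau u ^+ (i + (p.-1 - a)).
    rewrite mulr_sumr [RHS]big_mkcond; apply: eq_bigr => u _.
    rewrite /tchar; case: eqP => [_|/eqP u0]; first by rewrite mul0r.
    rewrite /= mulrCA exprD; congr (_ * _); rewrite mulrC; congr (_ * _).
    have t0 := tau_neq0 u0; rewrite exprVn.
    apply: (mulfI (expf_neq0 a t0)); rewrite divff ?expf_neq0//.
    by rewrite -exprD subnKC ?(ltnW ap)// -tauX expFp_pred.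
  rewrite tau_orth.
  have -> : (p.-1 %| i + (p.-1 - a))%N = (i %% p.-1 == a)%N.
    rewrite -{2}(modn_small ap) -(eqn_modDr (p.-1 - a)) subnKC ?(ltnW ap)//.
    by rewrite modnn.
  by case: ifP => _; rewrite ?mulr0 ?scale0r// [b i * _]mulrC.
rewrite /dwork_sum mulr_sumr scaler_suml; apply: pi_cong_sum => i /eqP ia.
have [B hB] := pi_red_Xn i; exists 0, ((p.-1%:R * b i) *: B); split; last first.
  by move=> j; rewrite coef0 mulr0; apply: dv0.
rewrite add0r -scalerAr -hB ia scalerBr scalerA; congr (_ - _ *: _); ring.
Qed.

Lemma dwork_sumO N a : dwork_sum N a \in O.
Proof.
rewrite -(dvE0 _ p); apply: dv_sum => i _; apply: dv_sign.
apply: (@dvW _ _ _ p_pr natF_neq0 (i %/ p %/ 4)) => //.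
by apply: dv_dwork_coef => //; apply: leq_div2l; lia.
Qed.

Lemma pi_coord_dwork_exp N c z : (0 < c < p.-1)%N ->
  pi_coord c (EN N (tau z)) = tau z ^+ c * dwork_sum N c.
Proof.
move=> /andP[c0 cp]; rewrite (@pi_coordE N) ?size_poly// /dwork_sum mulr_sumr.
apply: eq_bigr => i /eqP ic; rewrite coef_poly ltn_ord mulrA mulrC; congr (_ * _).
have [->|z0] := eqVneq z 0; last by rewrite tau_mod// ic.
rewrite tau0 !expr0n; case: (posnP i) => [i0|]; first by move: ic c0; rewrite i0 mod0n => <-.
by case: c c0 {ic cp} => // c _; case: (i : nat).
Qed.

(** Two computations of the coordinate on pi^c of a product of Gauss sums. By [gauss_poly_cong] the
    product is a multiple of T^(sumn l). By [prod_gauss_poly] it is a sum over z, in which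
    [jacobi_conv_scale] makes all z != 0 contribute equally, while z = 0 contributes nothing because
    c > 0. *)
Lemma jacobi_conv_dwork_sum n N l : (p * 4 * n.+1 <= N)%N ->
  all (fun a => a < p.-1)%N l -> (0 < sumn l %% p.-1)%N ->
  dv n ((\prod_(a <- l) (p.-1%:R * dwork_sum N a)) * (- p%:R) ^+ (sumn l %/ p.-1)
        - p.-1%:R * jacobi_conv l 1 * dwork_sum N (sumn l %% p.-1)).
Proof.
move=> nN la c0; set c := (sumn l %% p.-1)%N in c0 *.
have cp : (c < p.-1)%N by rewrite ltn_mod.
have h1 : cong n (\prod_(a <- l) gauss_poly N a)
    ((\prod_(a <- l) (p.-1%:R * dwork_sum N a)) *: 'X^(sumn l)).
  elim: l la {c c0 cp} => [|a l IH] /=.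
    by move=> _; rewrite !big_nil scale1r; apply: pi_cong_refl.
  move=> /andP[ap la]; rewrite !big_cons exprD.
  rewrite -scalerA scalerAr scalerAl; apply: pi_congM.
  - exact: lat_gauss_poly.
  - apply: latZ; last exact: latXn.
    by rewrite rpred_prod// => a' _; rewrite rpredM ?rpred_nat ?dwork_sumO.
  - exact: gauss_poly_cong.
  - exact: IH.
have := dv_pi_coord c (pi_cong_trans (pi_cong_sym h1) (prod_gauss_poly l nN)).
rewrite pi_coordZ pi_coordXn eqxx pi_coord_sum.
rewrite [X in _ - X](_ : _ = p.-1%:R * jacobi_conv l 1 * dwork_sum N c)//.
rewrite (eq_bigr (fun z => jacobi_conv l z * (tau z ^+ c * dwork_sum N c))) => [|z _].
  rewrite (bigD1 0)//= tau0 expr0n (gtn_eqF c0) mul0r mulr0 add0r.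
  rewrite (eq_bigr (fun=> jacobi_conv l 1 * dwork_sum N c)) => [|z z0].
    rewrite sumr_const -[in RHS]mulrA mulr_natl; congr (_ *+ _).
    by rewrite (eq_card (B := predC1 (0 : 'F_p))) ?cardC1 ?card_Fp// => u; rewrite !inE.
  rewrite -{1}[z]mulr1 jacobi_conv_scale// /tchar (negPf z0) exprVn (tau_mod (sumn l))//.
  by rewrite -/c; field; rewrite expf_neq0 ?tau_neq0.
by rewrite pi_coordZ pi_coord_dwork_exp ?c0.
Qed.

Variable gam : nat -> F.
Hypothesis gamP : forall a, (a < p.-1)%N -> forall n, exists N0, forall N,
  (N0 <= N)%N -> dv n (gam a - (1 - p%:R) * dwork_sum (N * p.-1) a).
Hypothesis dv_eq0 : forall x, (forall n, dv n x) -> x = 0.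

Lemma dvM_cong n x x' y y' : x' \in O -> y' \in O ->
  dv n (x - x') -> dv n (y - y') -> dv n (x * y - x' * y').
Proof.
move=> x'O y'O hx hy.
have -> : x * y - x' * y' = (x - x') * (y - y') + x' * (y - y') + y' * (x - x').
  by ring.
apply: dvD; [apply: dvD|]; try exact: dvMO.
by apply: (@dvW _ _ _ p_pr natF_neq0 (n + n)); [rewrite leq_addr | apply: dvM].
Qed.

Let predF : p.-1%:R = p%:R - 1 :> F.
Proof. by rewrite -subn1 natrB. Qed.

(** The numbers (p-1) [dwork_sum] tend p-adically to -[gam], so [jacobi_conv_dwork_sum] becomes an
    exact identity in the limit; this is also the source of the signs. *)
Theorem jacobi_conv_gamma l :
  all (fun a => a < p.-1)%N l -> (0 < sumn l %% p.-1)%N ->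
  jacobi_conv l 1 * gam (sumn l %% p.-1) =
  - (-1) ^+ size l * (\prod_(a <- l) gam a) * (- p%:R) ^+ (sumn l %/ p.-1).
Proof.
move=> la c0; set c := (sumn l %% p.-1)%N in c0 *.
have cp : (c < p.-1)%N by rewrite ltn_mod.
apply/eqP; rewrite -subr_eq0; apply/eqP; apply: dv_eq0 => n.
have [N1 hN1] := gamP cp n.
have [N2 hN2] : exists N0, forall N, (N0 <= N)%N ->
    dv n ((-1) ^+ size l * \prod_(a <- l) gam a -
      \prod_(a <- l) (p.-1%:R * dwork_sum (N * p.-1) a)).
  elim: l la {c c0 cp N1 hN1} => [|a l IH] /=.
    by exists 0%N => N _; rewrite !big_nil expr0 mulr1 subrr; apply: dv0.
  move=> /andP[ap /IH[N2 hN2]]; have [N1 hN1] := gamP ap n.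
  exists (maxn N1 N2) => N; rewrite geq_max => /andP[n1 n2]; rewrite !big_cons.
  have {}hN2 := hN2 _ n2; have {}hN1 := hN1 _ n1.
  rewrite exprS mulrACA; apply: dvM_cong => //.
  - by rewrite rpredM ?rpred_nat ?dwork_sumO.
  - by rewrite rpred_prod// => a' _; rewrite rpredM ?rpred_nat ?dwork_sumO.
  by have := dvN hN1; rewrite predF; congr dv; ring.
set N := maxn (maxn N1 N2) (p * 4 * n.+1).
have h1 := hN1 N (leq_trans (leq_maxl _ _) (leq_maxl _ _)).
have h2 := hN2 N (leq_trans (leq_maxr _ _) (leq_maxl _ _)).
have hN : (p * 4 * n.+1 <= N * p.-1)%N.
  by rewrite (leq_trans (leq_maxr _ _ : _ <= N)%N)// leq_pmulr.
have h3 := jacobi_conv_dwork_sum hN la c0.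
have := dvD (dvD (dvMO (jacobi_convO l 1) h1)
  (dvMO (_ : (- p%:R) ^+ (sumn l %/ p.-1) \in O) h2)) h3.
rewrite rpredX ?rpredN ?rpred_nat// -/c => /(_ isT).
by congr dv; rewrite predF; ring.
Qed.

End Gauss.

(** * The Gamma function as a power series *)

Section DworkGamma.
Variables (F : fieldType) (O : subringClosed F) (p : nat).
Hypothesis p_pr : prime p.
Hypothesis p_gt3 : (3 < p)%N.
Hypothesis natF_neq0 : forall m, m.+1%:R != 0 :> F.
Hypothesis O_invn : forall m, ~~ (p %| m)%N -> (m%:R : F)^-1 \in O.
Implicit Types (x y : F) (n m k K N a : nat).

Let p_gt0 : (0 < p)%N. Proof. exact: prime_gt0. Qed.
Let p1_gt0 : (0 < p.-1)%N. Proof. by lia. Qed.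

Local Notation b := (dwork_coef F p).
Local Notation dv := (dv O p).
Local Notation EN := (dwork_exp p).

Let pF : p%:R != 0 :> F := pF_neq0 p_pr natF_neq0.
Let p1F : p.-1%:R != 0 :> F.
Proof. by rewrite -(prednK p1_gt0). Qed.
Let predF : p.-1%:R = p%:R - 1 :> F.
Proof. by rewrite -subn1 natrB. Qed.

Definition poch x k : F := \prod_(i < k) (x + i%:R).

Lemma pochS x k : poch x k.+1 = poch x k * (x + k%:R).
Proof. by rewrite /poch big_ord_recr. Qed.

Lemma pochSl x k : poch x k.+1 = x * poch (x + 1) k.
Proof.
rewrite /poch big_ord_recl addr0; congr (_ * _); apply: eq_bigr => i _.
by rewrite /= /bump/= natrD addrA.
Qed.

Lemma pochO x k : x \in O -> poch x k \in O.
Proof. by move=> xO; rewrite rpred_prod// => i _; rewrite rpredD ?rpred_nat. Qed.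

Lemma poch_cong n x y k : x \in O -> y \in O ->
  dv n (x - y) -> dv n (poch x k - poch y k).
Proof.
move=> xO yO h; elim: k => [|k IH]; first by rewrite /poch !big_ord0 subrr; apply: dv0.
rewrite !pochS; apply: dvM_cong => //; rewrite ?pochO ?rpredD ?rpred_nat//.
by rewrite opprD addrACA subrr addr0.
Qed.

Lemma poch_opp m k : poch (- m%:R) k = (-1) ^+ k * (m ^_ k)%:R.
Proof.
elim: k => [|k IH]; first by rewrite /poch big_ord0 mulr1.
rewrite pochS IH ffactnSr natrM exprS; case: (leqP k m) => km.
  by rewrite natrB//; ring.
by rewrite ffact_small// !(mul0r, mulr0).
Qed.

(** The coefficient of T^n in exp(T) = E(T) exp(-T^p/p). *)
Lemma inv_fact_dwork n :
  n`!%:R^-1 = \sum_(k < n.+1 | (k * p <= n)%N)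
    (- p%:R^-1) ^+ k / k`!%:R * b (n - k * p).
Proof.
pose N := n.+1; pose Q : {poly F} := - p%:R^-1 *: 'X^p.
have Q0 : Q`_0 = 0 by rewrite coefZ coefXn ltn_eqF// mulr0.
have H : eqT N (\poly_(i < N) i`!%:R^-1) (EN N 1 * texp N Q).
  apply: (ode_unique natF_neq0 (D := 1)).
  - rewrite coef0M !coef_poly/= texp_coef0// fact0 (dwork_coef0 F p_pr).
    by rewrite expr0 invr1 !mulr1.
  - move=> i iN; rewrite mul1r coef_deriv !coef_poly.
    rewrite !ifT; try by rewrite /N /= in iN *; lia.
    rewrite factS natrM invfM; set u := _^-1.
    by rewrite mulrC -mulrnAr -[u *+ _]mulr_natr mulVf ?mulr1.
  move=> i iN; rewrite (ode_mul (@dwork_exp_ode F p p_pr p_gt3 natF_neq0 N 1)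
    (texp_ode natF_neq0 Q0))//.
  congr (nth 0 (polyseq (_ * _)) i).
  rewrite derivZ derivXn -scaler_nat scalerA mulNr mulVf// expr1n scale1r scaleN1r.
  by rewrite addrK.
have := H n (ltnSn n); rewrite coef_poly ltnSn => ->.
rewrite /texp mulr_sumr coef_sum [RHS]big_mkcond; apply: eq_bigr => k _.
rewrite exprZn scalerA -scalerAr coefZ -exprM mulrC coefMXn coef_poly.
rewrite expr1n mulr1 ltnS leq_subr mulnC ltnNge.
rewrite if_neg; case: ifP => //= _; last by rewrite mul0r.
by rewrite mulrC [_^-1 * _]mulrC.
Qed.

(* The left hand side is the value of Gamma_p at -(r + m p). *)
Lemma dwork_expansion r m K : (r < p)%N -> (m < K)%N ->
  (- p%:R) ^+ m * m`!%:R / (r + m * p)`!%:R =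
  \sum_(k < K) p%:R ^+ k * poch (- m%:R) k * b (r + k * p).
Proof.
move=> rp mK; rewrite inv_fact_dwork mulr_sumr.
rewrite -(subnKC mK) [RHS]big_split_ord/= [X in _ = _ + X]big1 ?addr0 => [|k _]; last first.
  by rewrite poch_opp ffact_small ?mulr0 ?mul0r// leq_addr.
have mn : (m.+1 <= (r + m * p).+1)%N by nia.
pose f k := (- p%:R) ^+ m * m`!%:R * ((- p%:R^-1) ^+ k / k`!%:R * b (r + m * p - k * p)).
rewrite (eq_bigl (fun k : 'I__ => k < m.+1)%N) => [|k]; last first.
  by apply/idP/idP; nia.
rewrite -(big_ord_widen _ f mn) (reindex_inj rev_ord_inj)/=.
apply: eq_bigr => k _; rewrite /f subSS poch_opp.
have km : (k <= m)%N by rewrite -ltnS.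
have -> : (r + m * p - (m - k) * p = r + k * p)%N by nia.
rewrite -(ffact_fact km) natrM -{1}(subnKC km) exprD exprNn !mulrA; congr (_ * _).
rewrite mulrC !mulrA; set u := (- p%:R) ^+ _; set v := (- p%:R^-1) ^+ _.
have uv : u * v = 1 by rewrite -exprMn mulrNN mulfV// expr1n.
have kF := factF_neq0 natF_neq0 (m - k).
transitivity (u * v * ((-1) ^+ k * p%:R ^+ k * (m ^_ k)%:R)); last by rewrite uv; ring.
by field.
Qed.

Lemma dv_dwork_le n k K : (n %/ p <= k)%N -> (K <= n %/ p %/ 4)%N ->
  dv K (p%:R ^+ k * b n).
Proof. by move=> h1 h2; apply: (dvW p_pr natF_neq0 h2); apply: dv_dwork_coef. Qed.

Section Sum.
Variable r : nat.
Hypothesis r_gt0 : (0 < r < p)%N.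
Let x : F := r%:R / p.-1%:R.

Let xO : x \in O.
Proof. by rewrite rpredM ?rpred_nat// O_invn// gtnNdvd//; lia. Qed.

(** At [m = 0] this is the sum in [dwork_expansion] with the negative integer replaced by x =
    r/(p-1), the point where -r + p x = x. The other values of [m] serve the recurrence. *)
Definition dwork_tail K m : F :=
  \sum_(k < K) p%:R ^+ k * poch (x + m%:R) k * b (r + k * p + m * p.-1).

(* The terms telescope because r + K p + m (p-1) = p (x + m + K) - (x + m). *)
Lemma dwork_tail_rec K m : dwork_tail K.+1 m =
  (1 - p%:R) * b (r + m * p.-1) - p%:R * dwork_tail K m.+1
  + p%:R ^+ K.+1 * poch (x + m.+1%:R) K * b (r + K * p + m * p.-1).
Proof.
elim: K => [|K IH].
  rewrite /dwork_tail big_ord1 big_ord0 /poch !big_ord0 mul0n addn0; ring.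
rewrite /dwork_tail big_ord_recr /= -/(dwork_tail _ _) IH /dwork_tail [in RHS]big_ord_recr /=.
rewrite pochSl (_ : x + m%:R + 1 = x + m.+1%:R); last by rewrite -natr1 addrA.
rewrite pochS.
set I := (r + K.+1 * p + m * p.-1)%N.
have IE : I = I.-1.+1 by rewrite /I; lia.
have := dwork_coef_rec p_pr p_gt3 natF_neq0 I.-1; rewrite -IE ifT; last by rewrite /I; lia.
have -> : I.-1 = (r + K * p + m.+1 * p.-1)%N by rewrite /I; nia.
have -> : (I - p = r + K * p + m * p.-1)%N by rewrite /I; lia.
have -> : I%:R = p%:R * (x + m.+1%:R + K%:R) - (x + m%:R) :> F.
  rewrite /I !natrD !natrM predF -[m.+1%:R]natr1.
  have : x * (p%:R - 1) = r%:R by rewrite -predF /x divfK.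
  by move=> <-; ring.
set bI := b I; set b1 := b _; set b2 := b _ => e.
have e2 : b1 = (p%:R * (x + m.+1%:R + K%:R) - (x + m%:R)) * bI - b2.
  by rewrite e; ring.
by rewrite e2 !exprS; ring.
Qed.

Definition dwork_series K : F := \sum_(m < K) (- p%:R) ^+ m * b (r + m * p.-1).

(** Iterating [dwork_tail_rec] produces the alternating series, and [dv_dwork_le] makes the
    remainders small. The divisor 8 is the 4 of that estimate, doubled because p-1 >= p/2. *)
Lemma dv_dwork_tail K m :
  dv ((m + K).-1 %/ 8) (p%:R ^+ m * (dwork_tail K m -
    (1 - p%:R) * \sum_(j < K) (- p%:R) ^+ j * b (r + (m + j) * p.-1))).
Proof.
elim: K m => [|K IH] m.
  by rewrite /dwork_tail !big_ord0 mulr0 subrr mulr0; apply: dv0.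
rewrite dwork_tail_rec big_ord_recl expr0 mul1r addn0.
have -> : \sum_(i < K) (- p%:R) ^+ lift ord0 i * b (r + (m + lift ord0 i) * p.-1)
   = - p%:R * \sum_(j < K) (- p%:R) ^+ j * b (r + (m.+1 + j) * p.-1).
  rewrite mulr_sumr; apply: eq_bigr => i _.
  by rewrite /= /bump/= add1n exprS addnS mulrA.
set T := dwork_tail K m.+1; set S := \sum_(_ < _) _.
set P := poch _ _; set bb := b (r + K * p + _).
rewrite [X in dv _ X](_ : _ = P * (p%:R ^+ (m + K).+1 * bb) -
   p%:R ^+ m.+1 * (T - (1 - p%:R) * S)); last by rewrite !exprS exprD; ring.
rewrite addnS /=; apply: dvB; last by have := IH m.+1; rewrite addSn.
apply: dvMO; first by rewrite pochO ?rpredD ?rpred_nat.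
apply: dv_dwork_le.
  by rewrite -ltnS ltn_divLR//; nia.
rewrite -divnMA leq_divRL; last by lia.
have := leq_trunc_div (m + K) 8; nia.
Qed.

Lemma dwork_gamma G :
  (forall n, exists2 m, dv n (x + m%:R) &
    dv n (G - (- p%:R) ^+ m * m`!%:R / (r + m * p)`!%:R)) ->
  forall n, exists N0, forall N, (N0 <= N)%N ->
    dv n (G - (1 - p%:R) * dwork_series N).
Proof.
(* The error in [dv_dwork_tail] at [m = 0] is p^((K-1) %/ 8), hence this threshold. *)
move=> HG n; exists (8 * n).+1 => K hK.
have [m hm hG] := HG n; set g := _ / _ in hG.
(* [K'] exceeds [m], so that the expansion at the negative integer is complete, and is at least [K],
   so that only small terms separate the two tails. *)
pose K' := maxn m.+1 K.
have rp : (r < p)%N by case/andP: r_gt0.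
have gE : g = \sum_(k < K') p%:R ^+ k * poch (- m%:R) k * b (r + k * p).
  by apply: dwork_expansion; rewrite ?leq_maxl.
have -> : G - (1 - p%:R) * dwork_series K = (G - g) + (g - dwork_tail K' 0) +
   (dwork_tail K' 0 - dwork_tail K 0) + (dwork_tail K 0 - (1 - p%:R) * dwork_series K).
  by ring.
apply: dvD; [apply: dvD; [apply: dvD => //|]|].
- rewrite gE /dwork_tail -sumrB; apply: dv_sum => k _.
  rewrite addr0 mul0n addn0 -mulrBl -mulrBr mulrAC mulrC.
  rewrite -[n]addn0; apply: dvM; last by apply: dv_dwork_le; rewrite // -ltnS ltn_divLR//; nia.
  apply: poch_cong => //; first by rewrite rpredN rpred_nat.
  by rewrite -opprD addrC; apply: dvN.
- have /subnKC <- : (K <= K')%N by rewrite leq_maxr.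
  rewrite /dwork_tail big_split_ord/= addrAC subrr add0r; apply: dv_sum => k _.
  rewrite mul0n addn0 mulrAC mulrC; apply: dvMO.
    by rewrite pochO ?rpredD ?rpred_nat.
  apply: dv_dwork_le; first by rewrite -ltnS ltn_divLR//; nia.
  rewrite -divnMA leq_divRL; last by lia.
  by nia.
have := dv_dwork_tail K 0; rewrite expr0 mul1r add0n.
rewrite /dwork_series.
by apply: (dvW p_pr natF_neq0); rewrite leq_divRL; lia.
Qed.

End Sum.

Lemma dwork_sum_series K a : (a < p.-1)%N ->
  dwork_sum F p (K * p.-1) a = dwork_series a K.
Proof.
move=> ap; rewrite /dwork_sum /dwork_series; elim: K => [|K IH].
  by rewrite !big_ord0.
rewrite big_ord_recr /= -IH mulSnr big_split_ord/=; congr (_ + _).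
rewrite (bigD1 (Ordinal ap))/=; last by rewrite modnMDl modn_small.
rewrite divnMDl// divn_small// addn0 addnC big1 ?addr0// => i /andP[/eqP e ne].
by case/negP: ne; apply/eqP/val_inj => /=; rewrite -e modnMDl modn_small.
Qed.

(** Removing the constant term moves the residue 0 to r = p-1, a value that [dwork_gamma] covers,
    unlike r = 0. *)
Lemma dwork_series0 K : dwork_series 0 K.+1 = 1 - p%:R * dwork_series p.-1 K.
Proof.
rewrite /dwork_series big_ord_recl/= expr0 mul1r (dwork_coef0 F p_pr); congr (_ + _).
rewrite -mulNr mulr_sumr; apply: eq_bigr => i _.
by rewrite /bump/= add1n exprS mulrA add0n mulSn.
Qed.

End DworkGamma.

(** * The ring of p-adic integers and the p-adic Gamma function *)

Section FieldIdentities.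
Variable F : fieldType.
Implicit Types (u v w f g : F).

Lemma div_step_dvd u v w f g : v != 0 -> w != 0 -> g != 0 ->
  - (u * f / g) = - v * u * (w * f) / (w * v * g).
Proof. by move=> v0 w0 g0; field; rewrite v0 w0 g0. Qed.

Lemma div_step_ndvd u v f g : v != 0 -> g != 0 ->
  u * f / g = v * (u * f / (v * g)).
Proof. by move=> v0 g0; field; rewrite v0 g0. Qed.

Lemma div_reflect u v w f g : v != 0 -> f != 0 -> g != 0 ->
  u * v * f / (v * f * g) * (w * g) = w * u.
Proof. by move=> v0 f0 g0; field; rewrite v0 f0 g0. Qed.

End FieldIdentities.

(** * The integers of Q_p and the functional equation of Gamma_p *)

Section PadicInteger.
Variables (p : nat) (p_pr : prime p).
Local Notation Zp := (padic_int p_pr).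
Local Notation Qp := (padic_num p_pr).
Local Notation tofrac := (@tofrac Zp).
Implicit Types (x y z : Zp) (n m k N : nat).

Let p_gt0 : (0 < p)%N. Proof. exact: prime_gt0. Qed.

Lemma padic_res_leq x y n m : (n <= m)%N -> x m = y m -> x n = y n.
Proof. by move=> nm e; rewrite -(padic_le x nm) -(padic_le y nm) e. Qed.

Lemma padic_resM_congr x x' y y' n :
  x n = x' n -> y n = y' n -> (x * y) n = (x' * y') n.
Proof. by rewrite !padic_resM => -> ->. Qed.

Lemma padic_resD_congr x x' y y' n :
  x n = x' n -> y n = y' n -> (x + y) n = (x' + y') n.
Proof. by rewrite !padic_resD => -> ->. Qed.

Lemma padic_resX_congr x y k n : x n = y n -> (x ^+ k) n = (y ^+ k) n.
Proof. by rewrite !padic_resX => ->. Qed.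

Lemma padic_res_pX n x : (p%:R ^+ n * x) n = 0%N.
Proof. by rewrite padic_resM -natrX padic_res_nat modnn mul0n mod0n. Qed.

Lemma padic_res_eq_sub x y n : x n = y n <-> (x - y) n = 0%N.
Proof.
split=> [e|e].
  by rewrite -(padic_res0 p_pr n) -(subrr y); apply: padic_resD_congr.
by rewrite -[x](subrK y) -{3}[y]add0r; apply: padic_resD_congr; rewrite ?padic_res0.
Qed.

Lemma padic_res_eq0 x n : x n = 0%N -> exists y, x = p%:R ^+ n * y.
Proof.
move=> xn.
have dvd k : (p ^ n %| x (k + n))%N by rewrite /dvdn padic_le ?leq_addl// xn.
have pn0 : (0 < p ^ n)%N by rewrite expn_gt0 p_gt0.
have hf k : (x (k.+1 + n) %/ p ^ n = x (k + n) %/ p ^ n %[mod p ^ k])%N.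
  apply/eqP; rewrite -(eqn_pmul2r pn0) !muln_modl// -!expnD !divnK// addSn.
  by rewrite padic_modS.
exists (padic_of p_pr hf); apply: padicP => k.
have -> : x k = (x (k + n) %% p ^ k)%N by rewrite padic_le ?leq_addr.
rewrite padic_resM -natrX padic_res_nat modnMml /= modnMmr.
by rewrite mulnC divnK.
Qed.

Lemma padic_natr_neq0 m : m.+1%:R != 0 :> Zp.
Proof.
apply/eqP => /(congr1 (fun z : Zp => z m.+1)).
by rewrite padic_res_nat padic_res0 modn_small// ltn_expl// prime_gt1.
Qed.

Lemma padic_num_natr_neq0 m : m.+1%:R != 0 :> Qp.
Proof. by rewrite -(rmorph_nat tofrac) tofrac_eq0 padic_natr_neq0. Qed.

Lemma padic_num_natr_gt0 m : (0 < m)%N -> m%:R != 0 :> Qp.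
Proof. by case: m => // m _; apply: padic_num_natr_neq0. Qed.

Lemma padic_num_p_neq0 : p%:R != 0 :> Qp.
Proof. exact: padic_num_natr_gt0. Qed.

Lemma padic_natr_unit m : (m%:R : Zp) \is a GRing.unit = ~~ (p %| m)%N.
Proof. by rewrite padic_unitE padic_res_nat expn1. Qed.

Definition padic_integer : {pred Qp} := fun u => `[< exists y, u = tofrac y >].

Lemma padic_integerP (u : Qp) : reflect (exists y, u = tofrac y) (u \in padic_integer).
Proof. exact: asboolP. Qed.

Lemma tofrac_integer x : tofrac x \in padic_integer.
Proof. by apply/padic_integerP; exists x. Qed.

Fact padic_integer_subring : subring_closed padic_integer.
Proof.
split=> [|x y|x y]; first by apply/padic_integerP; exists 1; rewrite rmorph1.
  move=> /padic_integerP[u ->] /padic_integerP[v ->]; rewrite -rmorphB.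
  exact: tofrac_integer.
move=> /padic_integerP[u ->] /padic_integerP[v ->]; rewrite -rmorphM.
exact: tofrac_integer.
Qed.
HB.instance Definition _ :=
  GRing.isSubringClosed.Build Qp padic_integer padic_integer_subring.

Lemma tofracV x : x \is a GRing.unit -> tofrac x^-1 = (tofrac x)^-1.
Proof.
move=> ux; have x0 : tofrac x != 0 by rewrite tofrac_eq0; apply: contraTneq ux => ->; rewrite unitr0.
by apply: (mulfI x0); rewrite -rmorphM/= !divrr// rmorph1.
Qed.

Lemma padic_integer_invn m : ~~ (p %| m)%N -> (m%:R : Qp)^-1 \in padic_integer.
Proof.
rewrite -padic_natr_unit => um.
by rewrite -(rmorph_nat tofrac) -tofracV ?tofrac_integer.
Qed.

Local Notation dv := (@dv Qp padic_integer p).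

Lemma dv_tofrac n x : x n = 0%N -> dv n (tofrac x).
Proof.
move=> /padic_res_eq0[y ->]; rewrite dvE rmorphM rmorphXn rmorph_nat mulrC mulKf.
  exact: tofrac_integer.
by rewrite expf_neq0// padic_num_p_neq0.
Qed.

Lemma dv_padic_eq0 (x : Qp) : (forall n, dv n x) -> x = 0.
Proof.
have pX n : p%:R ^+ n != 0 :> Qp.
  by rewrite expf_neq0// padic_num_p_neq0.
move=> h; have /padic_integerP[y e] := h 0%N; rewrite expr0 divr1 in e.
have y0 : y = 0; last by rewrite e y0 rmorph0.
apply: padicP => n; rewrite padic_res0.
have /padic_integerP[z ez] := h n.
have : tofrac y = tofrac (p%:R ^+ n * z).
  by rewrite rmorphM/= rmorphXn/= rmorph_nat -ez -e mulrC divfK ?pX.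
by move=> /eqP; rewrite tofrac_eq => /eqP ->; rewrite padic_res_pX.
Qed.

Lemma padic_res_inj x y : (forall n, exists2 k, (n <= k)%N & x k = y k) -> x = y.
Proof. by move=> h; apply: padicP => n; have [k nk] := h n; apply: padic_res_leq. Qed.

Section Gamma.
Hypothesis p_odd : odd p.
Local Notation Gam := (@padic_Gamma p p_pr).

Lemma padic_Gamma_cont x n : exists N, forall y, x N = y N -> Gam x n = Gam y n.
Proof.
have [N hN] := padic_Gamma_limit p_odd x n; exists N => y xy.
have [N' hN'] := padic_Gamma_limit p_odd y n.
pose m := y (maxn N N').
have my M : (M <= maxn N N')%N -> (m%:R : Zp) M = y M.
  by move=> le; rewrite padic_res_nat padic_le.
rewrite -(hN m) -?(hN' m)//; first by rewrite my// leq_maxr.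
by rewrite my ?leq_maxl.
Qed.

(** The quotient Gamma_p(x+1) / Gamma_p(x). *)
Definition Gamma_step x : Zp := if x \is a GRing.unit then - x else -1.

Lemma morita_natS m : morita_nat p_pr m.+1 = Gamma_step m%:R * morita_nat p_pr m.
Proof.
rewrite /Gamma_step padic_natr_unit /morita_nat exprS.
case: m => [|m]; first by rewrite dvdn0 !big_geq//= expr0 !mulr1.
rewrite [in LHS]big_mkcond big_nat_recr//= -big_mkcond /=.
case: ifP => _; rewrite ?muln1 ?natrM ?expr0; ring.
Qed.

Lemma padic_GammaS x : Gam (x + 1) = Gamma_step x * Gam x.
Proof.
apply: padicP => n.
have [N hN] := padic_Gamma_limit p_odd x n.
have [N' hN'] := padic_Gamma_limit p_odd (x + 1) n.
pose K := maxn (maxn N N') (maxn n 1).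
have [NK N'K nK K1] : [/\ N <= K, N' <= K, n <= K & 1 <= K]%N by rewrite /K; split; lia.
pose m := x K.
have mx M : (M <= K)%N -> (m%:R : Zp) M = x M.
  by move=> le; rewrite padic_res_nat padic_le.
rewrite -(hN' m.+1); last first.
  by rewrite -natr1; apply: padic_resD_congr => //; apply: mx.
rewrite morita_natS; apply: padic_resM_congr; last by rewrite -(hN m)// mx.
rewrite /Gamma_step !padic_unitE mx//; case: ifP => // _.
by rewrite -[- m%:R]mulN1r -[- x]mulN1r; apply: padic_resM_congr; rewrite ?mx.
Qed.

Lemma padic_Gamma_nat m : Gam m%:R = morita_nat p_pr m.
Proof.
by apply: padicP => n; have [N hN] := padic_Gamma_limit p_odd m%:R n; rewrite (hN m).
Qed.

Lemma Gamma_stepN x : Gamma_step (- x) = if x \is a GRing.unit then x else -1.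
Proof. by rewrite /Gamma_step unitrN opprK. Qed.

Lemma padic_Gamma_oppS x : Gam (- x) = Gamma_step (- (x + 1)) * Gam (- (x + 1)).
Proof. by rewrite -padic_GammaS; congr Gam; ring. Qed.

(** Descending from Gamma_p(0) = 1, the functional equation divides by each integer up to n that is
    prime to p and changes the sign at each multiple of p. *)
Lemma padic_Gamma_opp n : tofrac (Gam (- n%:R)) =
  (- p%:R) ^+ (n %/ p) * (n %/ p)`!%:R / n`!%:R.
Proof.
have factQ k : k`!%:R != 0 :> Qp := factF_neq0 padic_num_natr_neq0 k.
elim: n => [|n IH].
  rewrite oppr0 -[0]/(0%:R) padic_Gamma_nat /morita_nat big_geq// div0n fact0.
  by rewrite !expr0 invr1 !mulr1 rmorph1.
have := congr1 tofrac (padic_Gamma_oppS n%:R).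
rewrite rmorphM /= {}IH natr1 Gamma_stepN padic_natr_unit divnS// factS.
have nQ := padic_num_natr_neq0 n; rewrite natrM.
case: (boolP (p %| n.+1)%N) => [dvd|ndvd]/=.
  rewrite rmorphN rmorph1 mulN1r => h; rewrite -[LHS]opprK -h.
  have e : n.+1%:R = (n %/ p).+1%:R * p%:R :> Qp.
    by rewrite -natrM -[in LHS](divnK dvd) divnS// dvd.
  have := nQ; rewrite e mulf_eq0 negb_or => /andP[q0 p0].
  rewrite add1n exprS factS natrM; exact: (div_step_dvd _ _ p0 q0 (factQ n)).
rewrite add0n rmorph_nat => e.
apply: (mulfI nQ); rewrite -e; exact: (div_step_ndvd _ _ nQ (factQ n)).
Qed.

Lemma Gamma_reflect_nat n :
  Gam (- n%:R) * Gam n.+1%:R = (-1) ^+ (n.+1 + n %/ p).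
Proof.
have factQ k : k`!%:R != 0 :> Qp := factF_neq0 padic_num_natr_neq0 k.
apply/eqP; rewrite -tofrac_eq rmorphM/= padic_Gamma_opp padic_Gamma_nat.
rewrite /morita_nat rmorphM/= !rmorphXn/= rmorphN rmorph1 rmorph_nat.
rewrite -/(pfree_fact p n) (fact_pfree n p_pr) !natrM natrX.
have pQ := padic_num_p_neq0.
have fQ : (pfree_fact p n)%:R != 0 :> Qp.
  exact/padic_num_natr_gt0/pfree_fact_gt0.
rewrite [in X in X * _]exprNn exprD; apply/eqP.
exact: (div_reflect _ _ (expf_neq0 _ pQ) (factQ _) fQ).
Qed.
End Gamma.
End PadicInteger.

(** * Gamma_p at multiples of 1/(p-1) *)

Section GammaValues.
Variables (p : nat) (p_pr : prime p).
Hypothesis p_gt3 : (3 < p)%N.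
Local Notation Zp := (padic_int p_pr).
Local Notation Qp := (padic_num p_pr).
Local Notation tofrac := (@tofrac Zp).
Local Notation Gam := (@padic_Gamma p p_pr).
Local Notation omega := (omega p_pr).
Local Notation dv := (@dv Qp (@padic_integer p p_pr) p).
Implicit Types (x y z : Zp) (n m k s r : nat).

Let p_gt0 : (0 < p)%N. Proof. exact: prime_gt0. Qed.
Let p1_gt0 : (0 < p.-1)%N. Proof. by lia. Qed.
Let p_odd : odd p. Proof. exact: prime_gt3_odd. Qed.

(** This is (p^k - 1)/(p - 1); its negative tends p-adically to 1/(p-1). *)
Definition geom k : nat := (\sum_(i < k) p ^ i)%N.

Lemma geomS k : geom k.+1 = (geom k * p + 1)%N.
Proof.
rewrite /geom big_ord_recl expn0 addnC big_distrl; congr (_ + _)%N.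
by apply: eq_bigr => i _; rewrite /= /bump/= add1n expnSr.
Qed.

Lemma geomE k : (geom k * p.-1 + 1 = p ^ k)%N.
Proof.
elim: k => [|k IH]; first by rewrite /geom big_ord0.
rewrite geomS expnS -IH; nia.
Qed.

Lemma geomSr k : geom k.+1 = (geom k + p ^ k)%N.
Proof. by rewrite /geom big_ord_recr. Qed.

Lemma odd_geom k : odd (geom k) = odd k.
Proof.
elim: k => [|k IH]; first by rewrite /geom big_ord0.
by rewrite geomS oddD oddM IH p_odd andbT addbT.
Qed.

Lemma pred_unit : (p.-1%:R : Zp) \is a GRing.unit.
Proof. by rewrite padic_natr_unit gtnNdvd//; lia. Qed.

Lemma two_unit : (2%:R : Zp) \is a GRing.unit.
Proof. by rewrite padic_natr_unit gtnNdvd//; lia. Qed.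

(* r/(p-1) is the p-adic limit of the negative integers - r (p^k-1)/(p-1). *)
Definition pfrac r : Zp := r%:R / p.-1%:R.

Lemma pfracD r s : pfrac (r + s) = pfrac r + pfrac s.
Proof. by rewrite /pfrac natrD mulrDl. Qed.

Lemma pfrac_pred : pfrac p.-1 = 1.
Proof. exact: (divrr pred_unit). Qed.

Lemma pfrac_geom r k : pfrac r + (r * geom k)%:R = p%:R ^+ k * pfrac r.
Proof.
have e : r%:R = pfrac r * p.-1%:R by rewrite /pfrac (divrK pred_unit).
rewrite natrM e -mulrA -natrM -{1}[pfrac r]mulr1 -mulrDr nat1r.
by rewrite -addn1 [(p.-1 * _)%N]mulnC geomE natrX mulrC.
Qed.

Definition gam r : Qp := tofrac (Gam (pfrac r)).

Lemma gamE r : gam r = tofrac (Gam (pfrac r)).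
Proof. by []. Qed.

Lemma gam0 : gam 0 = 1.
Proof.
have -> : gam 0 = tofrac (Gam 0%:R) by rewrite /gam /pfrac mul0r.
by rewrite (padic_Gamma_nat p_pr p_odd) /morita_nat big_geq// expr0 mulr1 rmorph1.
Qed.

Lemma tofrac_pfrac r : tofrac (pfrac r) = r%:R / p.-1%:R.
Proof. by rewrite rmorphM/= (tofracV pred_unit) !rmorph_nat. Qed.

Lemma pfrac_close r k N : (N <= k)%N -> pfrac r N = (- (r * geom k)%:R : Zp) N.
Proof.
move=> Nk; apply: (padic_res_leq Nk); apply/padic_res_eq_sub.
by rewrite opprK pfrac_geom padic_res_pX.
Qed.

(** With m = r [geom k], the integers -m and -(r + m p) both tend to r/(p-1), as [dwork_gamma]
    requires. *)
Lemma gam_series r : (0 < r < p)%N -> forall n, exists N0, forall N, (N0 <= N)%N ->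
  dv n (gam r - (1 - p%:R) * dwork_series Qp p r N).
Proof.
move=> rp; apply: (dwork_gamma p_pr p_gt3 (@padic_num_natr_neq0 p p_pr)
  (@padic_integer_invn p p_pr) rp) => n.
have [N0 hN0] := padic_Gamma_cont p_odd (pfrac r) n.
pose k := maxn n N0; exists (r * geom k)%N.
  rewrite -tofrac_pfrac -(rmorph_nat tofrac) -rmorphD/= pfrac_geom.
  apply: dv_tofrac; rewrite -(padic_res0 p_pr n).
  apply: (@padic_res_leq _ _ _ 0 _ k); first by rewrite leq_maxl.
  by rewrite padic_res_pX padic_res0.
have e : (r + r * geom k * p = r * geom k.+1)%N by rewrite geomS; lia.
have <- : tofrac (Gam (- (r * geom k.+1)%:R)) = (- p%:R) ^+ (r * geom k) *
    (r * geom k)`!%:R / (r + r * geom k * p)`!%:R.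
  rewrite (padic_Gamma_opp p_pr p_odd) -e addnC divnMDl// divn_small ?addn0//.
  by case/andP: rp.
rewrite /gam -rmorphB; apply: dv_tofrac; apply/padic_res_eq_sub; apply: hN0.
by apply: pfrac_close; rewrite leqW// leq_maxr.
Qed.

Lemma gam_pred : gam p.-1 = -1.
Proof.
have -> : gam p.-1 = tofrac (Gam 1%:R) by rewrite /gam pfrac_pred.
rewrite (padic_Gamma_nat p_pr p_odd) /morita_nat big_geq//.
by rewrite mulr1 expr1 rmorphN rmorph1.
Qed.

End GammaValues.

Lemma dwork_zero_identity (R : comRingType) (P S : R) :
  1 - (1 - P) * (1 - P * S) = - P * (-1 - (1 - P) * S).
Proof. ring. Qed.

Lemma cancel_dup (R : comUnitRingType) (a b A B C D t t1 t2 : R) :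
  a * b \is a GRing.unit ->
  a * A * (b * B) = C * (t1 * b * (t2 * a * D)) * t ->
  A * B = C * D * (t * t1 * t2).
Proof.
move=> uab e; apply: (mulrI uab).
have -> : a * b * (A * B) = a * A * (b * B) by ring.
by rewrite e; ring.
Qed.

(** * Jacobi sums, reflection and duplication for Gamma_p *)

Section GammaJacobi.
Variables (p : nat) (p_pr : prime p).
Hypothesis p_gt3 : (3 < p)%N.
Local Notation Zp := (padic_int p_pr).
Local Notation Qp := (padic_num p_pr).
Local Notation tofrac := (@tofrac Zp).
Local Notation Gam := (@padic_Gamma p p_pr).
Local Notation omega := (omega p_pr).
Local Notation dv := (@dv Qp (@padic_integer p p_pr) p).
Local Notation gam := (gam p_pr).
Local Notation pfrac := (pfrac p_pr).
Implicit Types (x y z : Zp) (n m k s r : nat).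

Let p_gt0 : (0 < p)%N. Proof. exact: prime_gt0. Qed.
Let p1_gt0 : (0 < p.-1)%N. Proof. by lia. Qed.
Let p_odd : odd p. Proof. exact: prime_gt3_odd. Qed.

Lemma gam_dwork_sum a : (a < p.-1)%N -> forall n, exists N0, forall N, (N0 <= N)%N ->
  dv n (gam a - (1 - p%:R) * dwork_sum Qp p (N * p.-1) a).
Proof.
case: a => [|a] ap n; last first.
  have [|N0 hN0] := @gam_series p p_pr p_gt3 a.+1 _ n; first by lia.
  by exists N0 => N /hN0; rewrite (dwork_sum_series Qp p_pr p_gt3 N ap).
have [|N0 hN0] := @gam_series p p_pr p_gt3 p.-1 _ n; first by lia.
exists N0.+1 => -[//|N] /hN0.
rewrite (dwork_sum_series Qp p_pr p_gt3 N.+1 ap) (dwork_series0 Qp p_pr N).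
rewrite (gam0 p_pr p_gt3) (gam_pred p_pr p_gt3) => h.
rewrite dwork_zero_identity; apply: dvMO h.
by rewrite rpredN rpred_nat.
Qed.

Lemma omega0 : omega 0 = 0.
Proof. by rewrite /Defs.omega teichmuller0 rmorph0. Qed.

Lemma omega1 : omega 1 = 1.
Proof. by rewrite /Defs.omega teichmuller1 rmorph1. Qed.

Lemma omegaM : {morph omega : u v / u * v}.
Proof. by move=> u v; rewrite /Defs.omega teichmullerM rmorphM. Qed.

Lemma omegaD u v : dv 1 (omega u + omega v - omega (u + v)).
Proof.
rewrite /Defs.omega -rmorphD/= -rmorphB/=; apply: dv_tofrac; apply/padic_res_eq_sub.
rewrite padic_resD !teichmuller_res1 expn1 /=.
by congr (_ %% _)%N; rewrite Fp_cast.
Qed.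

Lemma omega_inj1 u : omega u = 1 -> u = 1.
Proof.
move=> /eqP; rewrite -(rmorph1 tofrac) tofrac_eq => /eqP /(congr1 (fun z : Zp => z 1%N)).
rewrite teichmuller_res1 padic_res1 => e; apply: val_inj; rewrite /= e.
by rewrite expn1 -[X in (1 %% X)%N](Fp_cast p_pr).
Qed.

Notation jac := (jacobi_conv omega).

Lemma jacobi_conv_gam l :
  all (fun a => a < p.-1)%N l -> (0 < sumn l %% p.-1)%N ->
  jac l 1 * gam (sumn l %% p.-1) =
  - (-1) ^+ size l * (\prod_(a <- l) gam a) * (- p%:R) ^+ (sumn l %/ p.-1).
Proof.
move: l; apply: (@jacobi_conv_gamma Qp (@padic_integer p p_pr) p p_pr p_gt3
  (@padic_num_natr_neq0 p p_pr) (@padic_integer_invn p p_pr)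
  omega omega0 omega1 omegaM (fun u => tofrac_integer _) omegaD omega_inj1
  gam gam_dwork_sum (@dv_padic_eq0 p p_pr)).
Qed.

(** The limit of [Gamma_reflect_nat] at n = r [geom p k.+1], where -n tends to r/(p-1) and n + 1 to
    1 - r/(p-1). The sign does not depend on k because [geom p k.+1] and [geom p k] have opposite
    parities. *)
Lemma gam_reflect r : (0 < r < p.-1)%N -> gam r * gam (p.-1 - r) = - (-1) ^+ r.
Proof.
move=> rp; have H : Gam (pfrac r) * Gam (pfrac (p.-1 - r)) = - (-1) ^+ r; last first.
  by rewrite -rmorphM H rmorphN/= rmorphXn/= rmorphN rmorph1.
apply: padic_res_inj => n.
have [N1 hN1] := padic_Gamma_cont p_odd (pfrac r) n.
have [N2 hN2] := padic_Gamma_cont p_odd (pfrac (p.-1 - r)) n.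
exists n => //; pose k := maxn N1 N2.
have close N : (N <= k)%N -> pfrac r N = (- (r * geom p k.+1)%:R : Zp) N.
  by move=> Nk; apply: (pfrac_close p_pr p_gt3); rewrite leqW.
transitivity ((Gam (- (r * geom p k.+1)%:R) * Gam (r * geom p k.+1).+1%:R) n).
  apply: padic_resM_congr; first by rewrite (hN1 _ (close _ (leq_maxl _ _))).
  apply: hN2; rewrite -natr1.
  have -> : pfrac (p.-1 - r) = - pfrac r + 1.
    apply: (addIr (pfrac r)); rewrite -pfracD subnK; last by lia.
    by rewrite (pfrac_pred p_pr p_gt3) addrAC addNr add0r.
  apply: padic_resD_congr => //.
  have := close N2 (leq_maxr _ _) => /(padic_resM_congr (erefl ((-1 : Zp) N2))).
  by rewrite mulN1r mulN1r opprK.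
rewrite (Gamma_reflect_nat p_pr p_odd); congr (padic_res _ n).
have -> : (r * geom p k.+1 %/ p = r * geom p k)%N.
  by rewrite geomS mulnDr muln1 mulnA divnMDl// divn_small ?addn0//; lia.
rewrite addSn exprS mulN1r; congr (- _).
rewrite -signr_odd -[in RHS]signr_odd; congr (_ ^+ nat_of_bool _).
rewrite geomS oddD !oddM oddD oddM p_odd andbT addbT.
by case: (odd r); case: (odd _).
Qed.

Lemma gam_neq0 r : (r < p.-1)%N -> gam r != 0.
Proof.
case: (posnP r) => [->|r0] rp; first by rewrite (gam0 p_pr p_gt3) oner_neq0.
have := @gam_reflect r; rewrite r0 rp => /(_ isT) e; apply/eqP => g0.
by move: e; rewrite g0 mul0r => /esym/eqP; rewrite oppr_eq0 signr_eq0.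
Qed.

Lemma Gamma_step_unit x : Gamma_step x \is a GRing.unit.
Proof. by rewrite /Gamma_step; case: ifP; rewrite unitrN// unitr1. Qed.

Lemma sub_div_S n : (n.+1 - n.+1 %/ p = (n - n %/ p) + ~~ (p %| n.+1))%N.
Proof.
rewrite divnS//; have := leq_div n p.
by case: (p %| n.+1)%N => /=; lia.
Qed.

Lemma Gamma_step_opp_nat n : Gamma_step (- n%:R : Zp) =
  if (p %| n)%N then -1 else n%:R.
Proof. by rewrite Gamma_stepN padic_natr_unit if_neg. Qed.

Lemma Gamma_step_double n : Gamma_step (- n.*2%:R) =
  2%:R ^+ (~~ (p %| n.*2)%N) * Gamma_step (- n%:R : Zp).
Proof.
have -> : (p %| n.*2)%N = (p %| n)%N.
  by rewrite -mul2n Gauss_dvdr// coprimen2.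
rewrite !Gamma_step_opp_nat -mul2n Gauss_dvdr ?coprimen2//.
by case: (p %| n)%N; rewrite ?mul1r// natrM.
Qed.

Lemma Gamma_step_half n : Gamma_step (- n%:R) =
  2%:R ^+ (~~ (p %| n)%N) * Gamma_step (- (n%:R / 2%:R) : Zp).
Proof.
have u2 := two_unit p_pr p_gt3.
rewrite !Gamma_stepN unitrMl ?unitrV// padic_natr_unit.
case: (p %| n)%N => /=; first by rewrite expr0 mul1r.
by rewrite expr1 [RHS]mulrC (divrK u2).
Qed.

(** Going from l to l + 1, each of the two steps on the right is 2 times a step on the left, except
    that the 2 is absent at multiples of p. The exponent counts the integers up to 2l that are prime
    to p. *)
Lemma Gamma_dup_nat l : Gam (- l%:R) * Gam (2%:R^-1 - l%:R) =
  Gam 2%:R^-1 * Gam (- l.*2%:R) * 2%:R ^+ (l.*2 - l.*2 %/ p).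
Proof.
elim: l => [|l IH]; first by rewrite !oppr0 addr0 div0n mulr1 mulrC.
have u2 := two_unit p_pr p_gt3.
have e1 := padic_Gamma_oppS p_odd (l%:R : Zp).
have e2 := padic_GammaS p_odd (2%:R^-1 - l.+1%:R : Zp).
have e3 := padic_Gamma_oppS p_odd (l.*2%:R : Zp).
have e4 := padic_Gamma_oppS p_odd (l.*2.+1%:R : Zp).
rewrite natr1 in e1; rewrite natr1 in e3; rewrite natr1 in e4.
rewrite (_ : 2%:R^-1 - l.+1%:R + 1 = 2%:R^-1 - l%:R) in e2; last first.
  by rewrite -[l.+1%:R]natr1 opprD addrA subrK.
have d1 : Gamma_step (- l.*2.+2%:R) =
    2%:R ^+ (~~ (p %| l.*2.+2)%N) * Gamma_step (- l.+1%:R : Zp).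
  exact: (Gamma_step_double l.+1).
have d2 : Gamma_step (- l.*2.+1%:R) =
    2%:R ^+ (~~ (p %| l.*2.+1)%N) * Gamma_step (2%:R^-1 - l.+1%:R : Zp).
  rewrite Gamma_step_half; congr (_ * Gamma_step _).
  apply: (mulIr u2); rewrite mulNr (divrK u2) mulrBl (mulVr u2) -natrM.
  by rewrite muln2 doubleS -[l.*2.+2%:R]natr1 opprD addrCA subrr addr0.
rewrite doubleS !sub_div_S !exprD.
move: IH; rewrite e1 e2 e3 e4 d1 d2.
set a := Gamma_step _; set b := Gamma_step _; set A := Gam _; set B := Gam _.
set C := Gam _; set D := Gam _; set t := _ ^+ (_ - _).
set t1 := _ ^+ _; set t2 := _ ^+ _ => IH.
have uab : a * b \is a GRing.unit by rewrite unitrM !Gamma_step_unit.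
exact: (cancel_dup uab IH).
Qed.

Lemma teichmuller_approx (u : 'F_p) n K : (n <= K)%N ->
  ((u : nat)%:R ^+ (p ^ K) : Zp) n = teichmuller p_pr u n.
Proof.
move=> nK; apply: (padic_res_leq nK).
by rewrite -natrX padic_res_nat teichmuller_resE.
Qed.

Lemma gam_dup s : (s < p.-1)%N ->
  tofrac (Gam (pfrac s / 2%:R)) * tofrac (Gam (pfrac s / 2%:R + 2%:R^-1)) =
  tofrac (Gam 2%:R^-1) * omega 2%:R ^+ s * gam s.
Proof.
move=> sp; have u2 := two_unit p_pr p_gt3; set y := pfrac s / 2%:R.
have H : Gam y * Gam (y + 2%:R^-1) =
    Gam 2%:R^-1 * teichmuller p_pr 2%:R ^+ s * Gam (pfrac s); last first.
  by rewrite -rmorphM H rmorphM rmorphM/= rmorphXn.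
apply: padic_res_inj => n; exists n => //.
have [N1 hN1] := padic_Gamma_cont p_odd y n.
have [N2 hN2] := padic_Gamma_cont p_odd (y + 2%:R^-1) n.
have [N3 hN3] := padic_Gamma_cont p_odd (pfrac s) n.
(* [k] is odd, so [geom p k.+1] is even and [l] is exactly half of s times it. *)
pose K := (n + (N1 + (N2 + N3)))%N; pose k := K.*2.+1.
pose l := (s * (geom p k.+1)./2)%N.
have le : (l.*2 = s * geom p k.+1)%N.
  rewrite /l doubleMr -[in RHS](odd_double_half (geom p k.+1)).
  by rewrite (odd_geom p_pr p_gt3) /= odd_double.
have cl N : (N <= K)%N -> y N = (- l%:R : Zp) N.
  move=> NK; apply/padic_res_eq_sub.
  have -> : y - - l%:R = p%:R ^+ k.+1 * y.
    apply: (mulIr u2); rewrite opprK mulrDl -[RHS]mulrA /y (divrK u2).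
    by rewrite -natrM muln2 le (pfrac_geom p_pr p_gt3).
  rewrite -(padic_res0 p_pr N); apply: (@padic_res_leq _ _ _ 0 _ k.+1).
    by rewrite /k; lia.
  by rewrite padic_res_pX padic_res0.
have cs N : (N <= K)%N -> pfrac s N = (- l.*2%:R : Zp) N.
  by move=> NK; rewrite le; apply: (pfrac_close p_pr p_gt3); rewrite /k; lia.
have [nK N1K N2K N3K] : [/\ n <= K, N1 <= K, N2 <= K & N3 <= K]%N.
  by rewrite /K; split; lia.
transitivity ((Gam (- l%:R) * Gam (2%:R^-1 - l%:R)) n).
  apply: padic_resM_congr; first by rewrite (hN1 _ (cl _ N1K)).
  apply: hN2; rewrite addrC; apply: padic_resD_congr => //; exact: cl.
rewrite Gamma_dup_nat -[in RHS]mulrA [_ * Gam (pfrac s)]mulrC mulrA.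
apply: padic_resM_congr.
  by apply: padic_resM_congr => //; rewrite (hN3 _ (cs _ N3K)).
(* The exponent is s p^k, and 2^(p^k) tends to the Teichmueller lift of 2. *)
have -> : (l.*2 - l.*2 %/ p = p ^ k * s)%N.
  have -> : (l.*2 %/ p = s * geom p k)%N.
    by rewrite le geomS mulnDr muln1 mulnA divnMDl// divn_small ?addn0//; lia.
  by rewrite le geomSr; nia.
rewrite exprM; apply: padic_resX_congr.
rewrite -(@teichmuller_approx _ n k); last by rewrite /k; lia.
by rewrite val_Fp_nat// modn_small//; lia.
Qed.

End GammaJacobi.

(** * Character sums and points of the curve *)

Section CurveParam.
Variable K : fieldType.
Implicit Types x y z s l : K.
Hypothesis two_neq0 : 2%:R != 0 :> K.

Lemma four_neq0 : 4%:R != 0 :> K.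
Proof. by rewrite (natrM _ 2 2) mulf_neq0. Qed.

Lemma conic_eq x y z : x != 0 -> z != 0 ->
  (4%:R * x * y / z ^+ 2 == 1) = (y == z ^+ 2 / (4%:R * x)).
Proof.
move=> x0 z0; have f0 := four_neq0.
have e1 : (4%:R * x * y / z ^+ 2 == 1) = (4%:R * x * y == z ^+ 2).
  by rewrite -(inj_eq (mulIf (expf_neq0 2 z0))) mul1r divfK// expf_neq0.
rewrite e1 -(inj_eq (mulIf (mulf_neq0 f0 x0)) y) divfK ?mulf_neq0//.
by rewrite [y * _]mulrC.
Qed.

Lemma conic_param x s : x != 0 -> (2%:R * x * s) ^+ 2 / (4%:R * x) = x * s ^+ 2.
Proof. by move=> x0; have f0 := four_neq0; field; rewrite x0. Qed.

Lemma conic_rest x s : 1 - x - x * s ^+ 2 - 2%:R * x * s = 1 - x * (1 + s) ^+ 2.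
Proof. ring. Qed.

Lemma plane_eq l x s w : x != 0 -> s != 0 ->
  (6%:R * l * (x * s ^+ 2) * w / (x * (2%:R * x * s)) == 1) =
  (3%:R * l * s * w == x).
Proof.
move=> x0 s0.
have -> : 6%:R * l * (x * s ^+ 2) * w / (x * (2%:R * x * s)) = 3%:R * l * s * w / x.
  by field; rewrite x0 s0.
by rewrite -(inj_eq (mulIf x0)) mul1r divfK.
Qed.

Lemma line_eq l x s :
  (3%:R * l * s * (1 - x * (1 + s) ^+ 2) == x) =
  (x * (1 + 3%:R * l * s * (1 + s) ^+ 2) == 3%:R * l * s).
Proof.
rewrite -subr_eq0 -[RHS]subr_eq0 -oppr_eq0; congr (_ == 0); ring.
Qed.

Lemma DIK_inv l s : s != 0 ->
  (s^-1) ^+ 3 + 3%:R * l * (s^-1 + 1) ^+ 2 =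
  s * (1 + 3%:R * l * s * (1 + s) ^+ 2) * (s^-1 ^+ 2) ^+ 2.
Proof. by move=> s0; field. Qed.

End CurveParam.

Section FinFieldSum.
Variables (F : fieldType) (K : finFieldType) (phi : K -> F) (q : F).
Implicit Types (u v x y z s l : K).
Hypothesis two_neq0 : 2%:R != 0 :> K.
Hypothesis three_neq0 : 3%:R != 0 :> K.
Hypothesis phi0 : phi 0 = 0.
Hypothesis phiM : {morph phi : u v / u * v}.
Hypothesis phi_sqr : forall u, u != 0 -> phi u ^+ 2 = 1.
Hypothesis sum_phi : \sum_u phi u = 0.

Lemma phi_mul_sqr u v : v != 0 -> phi (u * v ^+ 2) = phi u.
Proof. by move=> v0; rewrite phiM expr2 phiM -expr2 phi_sqr// mulr1. Qed.

Lemma phi_div u v : phi (u / v) = phi (u * v).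
Proof.
have [->|v0] := eqVneq v 0; first by rewrite invr0 !mulr0.
by rewrite -(phi_mul_sqr (u / v) v0) expr2 mulrA divfK.
Qed.

Lemma phi1 : phi 1 = 1.
Proof. by rewrite -(phi_sqr (oner_neq0 K)) expr2 -phiM mulr1. Qed.

Definition quad_rest x y z := 1 - x - y - z.

Definition curve_poly l s := 1 + 3%:R * l * s * (1 + s) ^+ 2.

(** With z = 2 x s, the condition 4 x y = z^2 forces y = x s^2, so that phi(y) = phi(x). *)
Lemma quad_sum_param l :
  \sum_x \sum_y \sum_z
  (if [&& x != 0, y != 0, z != 0 & quad_rest x y z != 0] then
    phi y * ((6%:R * l * y * quad_rest x y z / (x * z) == 1)%:R * q - 1) *
      ((4%:R * x * y / z ^+ 2 == 1)%:R * q) else 0) =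
  \sum_(s | s != 0) \sum_(x | (x != 0) && (1 - x * (1 + s) ^+ 2 != 0))
    phi x * ((x * curve_poly l s == 3%:R * l * s)%:R * q - 1) * q.
Proof.
rewrite [RHS](exchange_big_dep (fun x => x != 0)) => [|s x _ /andP[]//].
rewrite [RHS]big_mkcond; apply: eq_bigr => x _.
case: ifP => [x0|_]; last by rewrite big1 // => y _; rewrite big1.
have xx0 : 2%:R * x != 0 by rewrite mulf_neq0.
rewrite [LHS]exchange_big.
rewrite [LHS](reindex_inj (mulfI xx0)).
rewrite [RHS]big_mkcond.
apply: eq_bigr => s _; rewrite mulf_eq0 (negPf xx0) /=.
case: (eqVneq s 0) => [->|s0] /=; first by rewrite big1// => y _; rewrite andbF.
rewrite (bigD1 (x * s ^+ 2))//= big1 ?addr0 => [|y ny]; last first.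
  rewrite conic_eq// ?mulf_neq0// conic_param// (negPf ny) mul0r mulr0 if_same.
  by [].
rewrite mulf_neq0 ?expf_neq0//= /quad_rest conic_rest conic_eq ?mulf_neq0//.
rewrite conic_param// eqxx mul1r plane_eq// line_eq phi_mul_sqr//.
by rewrite x0 ?s0.
Qed.

(** The only solution is x = 3 l s / D, and phi does not distinguish a quotient from a product. If D
    = 0 there is no solution, and the right-hand side vanishes too. *)
Lemma sum_phi_line l s : l != 0 -> s != 0 ->
  \sum_(x | (x != 0) && (1 - x * (1 + s) ^+ 2 != 0))
    phi x * (x * curve_poly l s == 3%:R * l * s)%:R = phi (3%:R * l) * phi (s * curve_poly l s).
Proof.
move=> l0 s0; set D := curve_poly l s.
have ls0 : 3%:R * l * s != 0 by rewrite !mulf_neq0.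
rewrite -phiM mulrA.
have [D0|D0] := eqVneq D 0.
  rewrite D0 mulr0 phi0 big1// => x _; rewrite mulr0 eq_sym (negPf ls0).
  by rewrite mulr0.
have eqD x : (x * D == 3%:R * l * s) = (x == 3%:R * l * s / D).
  by rewrite -(inj_eq (mulIf D0) x) divfK.
rewrite (bigD1 (3%:R * l * s / D)) /=.
  rewrite eqD eqxx mulr1 phi_div big1 ?addr0// => x /andP[_ ne].
  by rewrite eqD (negPf ne) mulr0.
set x := _ / D; have x0 : x != 0 by rewrite mulf_neq0 ?invr_eq0.
(* If 1 - x (1 + s)^2 vanished, the left equation of [line_eq] would give x = 0. *)
rewrite x0; apply: contraNneq x0 => w0.
have := line_eq l x s; rewrite w0 mulr0 -/(curve_poly l s) -/D eqD eqxx.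
by rewrite eq_sym.
Qed.

(** The sum of phi over all x is 0, and the only nonzero x left out is the square (1 + s)^-2, which
    exists unless s = -1. *)
Lemma sum_phi_conic s : \sum_(x | (x != 0) && (1 - x * (1 + s) ^+ 2 != 0)) phi x =
  - (s != -1)%:R.
Proof.
have -> : \sum_(x | (x != 0) && (1 - x * (1 + s) ^+ 2 != 0)) phi x =
    \sum_(x | 1 - x * (1 + s) ^+ 2 != 0) phi x.
  rewrite big_mkcond [RHS]big_mkcond; apply: eq_bigr => x _.
  by case: eqP => //= ->; rewrite phi0 if_same.
have := sum_phi; rewrite (bigID (fun x => 1 - x * (1 + s) ^+ 2 != 0))/=.
move/(canRL (addrK _)) ->; rewrite sub0r; congr (- _).
have [->|s1] := eqVneq s (-1).
  by rewrite subrr expr0n/= big1// => x; rewrite mulr0 subr0 oner_eq0.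
have t1 : 1 + s != 0 by rewrite addrC -[1]opprK subr_eq0.
have t0 : (1 + s) ^+ 2 != 0 by rewrite expf_neq0.
rewrite (big_pred1 ((1 + s) ^+ 2)^-1) => [|x]; last first.
  by rewrite negbK subr_eq0 eq_sym -[RHS](inj_eq (mulIf t0)) mulVf.
by rewrite -[_^-1]mul1r phi_div phi_mul_sqr// phi1.
Qed.

Theorem quad_sumE l : l != 0 -> \sum_x \sum_y \sum_z
  (if [&& x != 0, y != 0, z != 0 & quad_rest x y z != 0] then
    phi y * ((6%:R * l * y * quad_rest x y z / (x * z) == 1)%:R * q - 1) *
      ((4%:R * x * y / z ^+ 2 == 1)%:R * q) else 0) =
  q ^+ 2 * phi (3%:R * l) * \sum_(s | s != 0) phi (s * curve_poly l s)
  + q * (#|K| - 2)%:R.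
Proof.
move=> l0; rewrite quad_sum_param//.
have -> : (#|K| - 2)%:R = \sum_(s : K | s != 0) (s != -1)%:R :> F.
  rewrite -natr_sum; congr _%:R; rewrite -big_mkcondr/= sum1_card.
  rewrite [RHS](eq_card (B := predC (pred2 0 (-1)))) => [|s]; last first.
    by rewrite !inE negb_or.
  by rewrite -(cardC (pred2 0 (-1 : K))) card2 eq_sym oppr_eq0 oner_eq0 addKn.
rewrite !mulr_sumr -big_split; apply: eq_bigr => s s0 /=.
transitivity (q ^+ 2 * (phi (3%:R * l) * phi (s * curve_poly l s)) - q * (- (s != -1)%:R)); last by ring.
rewrite -sum_phi_line// -sum_phi_conic !mulr_sumr -sumrB.
by apply: eq_bigr => x _; ring.
Qed.

Lemma sum_phi_DIK l : \sum_x phi (x ^+ 3 + 3%:R * l * (x + 1) ^+ 2) =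
  phi (3%:R * l) + \sum_(s | s != 0) phi (s * curve_poly l s).
Proof.
rewrite (bigD1 0)//= (_ : 0 ^+ 3 + 3%:R * l * (0 + 1) ^+ 2 = 3%:R * l); last by ring.
congr (_ + _); rewrite (reindex_inj invr_inj)/=.
apply: eq_big => [s|s]; first by rewrite invr_eq0.
by rewrite invr_eq0 => s0; rewrite DIK_inv// phi_mul_sqr// expf_neq0// invr_eq0.
Qed.

End FinFieldSum.

(** * Orthogonality of characters and the point count *)

Section CharSum.
Variables (F : fieldType) (p : nat).
Hypothesis p_pr : prime p.
Hypothesis p_gt3 : (3 < p)%N.
Variable tau : 'F_p -> F.
Hypothesis tau0 : tau 0 = 0.
Hypothesis tau1 : tau 1 = 1.
Hypothesis tauM : {morph tau : u v / u * v}.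
Hypothesis tau_inj1 : forall u, tau u = 1 -> u = 1.
Implicit Types (u v w x y z s : 'F_p) (a r j : nat).

Local Notation P := p.-1.
Local Notation h := (p.-1./2).
Local Notation tchar := (tchar tau).
Local Notation jac := (jacobi_conv tau).

Let p_gt0 : (0 < p)%N. Proof. exact: prime_gt0. Qed.
Let P_gt0 : (0 < P)%N. Proof. by lia. Qed.
Let PE : P = h.*2. Proof. exact: prime_gt3_pred. Qed.
Let h_gt0 : (0 < h)%N. Proof. by lia. Qed.

Lemma Fp_nat_neq0 n : (0 < n < p)%N -> n%:R != 0 :> 'F_p.
Proof.
move=> /andP[n0 np]; apply/eqP => /(congr1 val); rewrite /= val_Fp_nat// modn_small//.
by move=> n0'; rewrite n0' in n0.
Qed.

Let two_neq0 : 2%:R != 0 :> 'F_p. Proof. by apply: Fp_nat_neq0; lia. Qed.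
Let three_neq0 : 3%:R != 0 :> 'F_p. Proof. by apply: Fp_nat_neq0; lia. Qed.

Let tP u : u != 0 -> tau u ^+ P = 1.
Proof. by move=> u0; rewrite -(tauX tau1 tauM) (expFp_pred p_pr u0) tau1. Qed.

Definition phi u : F := tau u ^+ h.

Lemma phi0 : phi 0 = 0.
Proof. by rewrite /phi tau0 expr0n gtn_eqF. Qed.

Lemma phiM u v : phi (u * v) = phi u * phi v.
Proof. by rewrite /phi tauM exprMn. Qed.

Lemma phi_sqr u : u != 0 -> phi u ^+ 2 = 1.
Proof. by move=> u0; rewrite /phi -exprM muln2 -PE tP. Qed.

Lemma sum_phi : \sum_u phi u = 0.
Proof.
rewrite (bigD1 0)//= phi0 add0r /phi (tau_orth p_pr p_gt3 tau1 tauM tau_inj1).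
by rewrite gtnNdvd//; lia.
Qed.

Lemma sum_tau_exp u : u != 0 ->
  \sum_(0 <= j < P) tau u ^+ j = (u == 1)%:R * P%:R.
Proof.
move=> u0; case: eqP => [->|/eqP u1].
  by rewrite tau1; under eq_bigr do rewrite expr1n; rewrite big_const_nat subn0 iter_addr_0 mul1r.
rewrite mul0r big_mkord; apply: (@mulfI _ (tau u - 1)).
  by rewrite subr_eq0; apply: contra u1 => /eqP/tau_inj1->.
by rewrite -subrX1 tP// subrr mulr0.
Qed.

Lemma tchar0 a : tchar a 0 = 0.
Proof. by rewrite tchar_def eqxx. Qed.

Lemma tchar_mod a u : tchar (a %% P) u = tchar a u.
Proof.
rewrite !tchar_def; case: eqP => // /eqP u0.
by rewrite -(tauV tau0 tau1 tauM) -(tau_mod p_pr tau1 tauM)// invr_eq0.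
Qed.

Lemma exprV_sub (t : F) j : t ^+ P = 1 -> (j <= P)%N -> t^-1 ^+ (P - j) = t ^+ j.
Proof.
move=> tP1 jP; have t0 : t != 0.
  by apply/eqP => t0; move: tP1; rewrite t0 expr0n (gtn_eqF P_gt0) => /eqP; rewrite eq_sym oner_eq0.
have tj : t^-1 ^+ j != 0 by rewrite expf_neq0// invr_eq0.
by apply: (mulIf tj); rewrite -exprD subnK// -exprMn divff// expr1n exprVn tP1 invr1.
Qed.

Lemma jac1 a z : jac [:: a] z = tchar a z.
Proof.
rewrite /= (bigD1 z)//= subrr eqxx mulr1 big1 ?addr0// => u uz.
by rewrite subr_eq0 eq_sym (negPf uz) mulr0.
Qed.

(* The exponents r - j, (p-1)/2 - r - j, r + 2j and -r modulo p - 1. *)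
Definition quad_exps r j : seq nat :=
  [:: (r + (P - j)) %% P; (h + (P - r) + (P - j)) %% P; (r + 2 * j) %% P; P - r]%N.

Lemma jac_quad r j : jac (quad_exps r j) 1 =
  \sum_(v : 'F_p * 'F_p * 'F_p) tchar (r + (P - j)) v.1.1 *
    tchar (h + (P - r) + (P - j)) v.1.2 * tchar (r + 2 * j) v.2 *
    tchar (P - r) (quad_rest v.1.1 v.1.2 v.2).
Proof.
rewrite -(pair_bigA _ (fun xy z => tchar (r + (P - j)) xy.1 *
    tchar (h + (P - r) + (P - j)) xy.2 * tchar (r + 2 * j) z *
    tchar (P - r) (quad_rest xy.1 xy.2 z)))/=.
rewrite -(pair_bigA _ (fun x y => \sum_z tchar (r + (P - j)) x *
    tchar (h + (P - r) + (P - j)) y * tchar (r + 2 * j) z *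
    tchar (P - r) (quad_rest x y z)))/=.
apply: eq_bigr => x _; rewrite tchar_mod mulr_sumr; apply: eq_bigr => y _.
rewrite tchar_mod mulrA mulr_sumr; apply: eq_bigr => z _.
by rewrite -/(jac [:: (P - r)%N] _) jac1 tchar_mod mulrA.
Qed.

(** Sorting the exponents by r, j and (p-1)/2 exhibits the two monomials that orthogonality will set
    equal to 1. *)
Lemma quad_term c r j x y z w : (r <= P)%N -> (j <= P)%N ->
  [&& x != 0, y != 0, z != 0 & w != 0] ->
  tau c ^+ r * tau 4%:R ^+ j * (tchar (r + (P - j)) x *
    tchar (h + (P - r) + (P - j)) y * tchar (r + 2 * j) z * tchar (P - r) w) =
  phi y * tau (c * y * w / (x * z)) ^+ r * tau (4%:R * x * y / z ^+ 2) ^+ j.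
Proof.
move=> rP jP /and4P[x0 y0 z0 w0].
rewrite !tchar_def (negPf x0) (negPf y0) (negPf z0) (negPf w0).
have tV := tauV tau0 tau1 tauM.
have hE : (tau y)^-1 ^+ h = tau y ^+ h.
  by rewrite -(exprV_sub (tP y0) (_ : h <= P)%N); [congr (_ ^+ _) | ]; lia.
rewrite [_ ^+ (r + (P - j))]exprD [_ ^+ (h + _ + _)]exprD [_ ^+ (h + _)]exprD.
rewrite [_ ^+ (r + 2 * j)]exprD [_ ^+ (2 * j)]exprM.
rewrite (exprV_sub (tP x0) jP) (exprV_sub (tP y0) jP) (exprV_sub (tP y0) rP).
rewrite (exprV_sub (tP w0) rP) hE /phi expr2 !tauM !tV !tauM !exprMn !exprVn !exprMn !invfM.
by ring.
Qed.

Lemma sum_pair3 (g : 'F_p -> 'F_p -> 'F_p -> F) :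
  \sum_(v : 'F_p * 'F_p * 'F_p) g v.1.1 v.1.2 v.2 = \sum_x \sum_y \sum_z g x y z.
Proof.
rewrite -(pair_bigA _ (fun xy z => g xy.1 xy.2 z))/=.
by rewrite -(pair_bigA _ (fun x y => \sum_z g x y z)).
Qed.

Definition charsum c : F := \sum_(1 <= r < P) \sum_(0 <= j < P)
  tau c ^+ r * tau 4%:R ^+ j * jac (quad_exps r j) 1.

(** The full sum over j gives p-1 times an indicator; the sum over r misses r = 0, whence the -1. *)
Lemma charsum_orth c : c != 0 -> charsum c = \sum_x \sum_y \sum_z
  (if [&& x != 0, y != 0, z != 0 & quad_rest x y z != 0] then
    phi y * ((c * y * quad_rest x y z / (x * z) == 1)%:R * P%:R - 1) *
      ((4%:R * x * y / z ^+ 2 == 1)%:R * P%:R) else 0).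
Proof.
move=> c0; rewrite -sum_pair3 /charsum.
under eq_big_nat => r /andP[r1 rP].
  under eq_big_nat => j /andP[_ jP].
    rewrite jac_quad mulr_sumr; over.
  rewrite exchange_big /=; over.
rewrite exchange_big /=; apply: eq_bigr => -[[x y] z] _ /=.
set w := quad_rest x y z; case: ifP => [nz|/negbT nz]; last first.
  rewrite big1 => // r _; rewrite big1 => // j _.
  move: nz; rewrite !negb_and !negbK => /or4P[] /eqP->; rewrite !tchar0; ring.
have f0 := four_neq0 two_neq0.
have /and4P[x0 y0 z0 w0] := nz.
transitivity (\sum_(1 <= r < P) \sum_(0 <= j < P)
    phi y * tau (c * y * w / (x * z)) ^+ r * tau (4%:R * x * y / z ^+ 2) ^+ j).
  apply: eq_big_nat => r /andP[r1 rP]; apply: eq_big_nat => j /andP[_ jP].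
  by apply: quad_term => //; exact: ltnW.
under eq_bigr do rewrite -mulr_sumr.
rewrite -mulr_suml -mulr_sumr !sum_tau_exp ?mulf_neq0 ?invr_eq0 ?mulf_neq0 ?expf_neq0//.
congr (_ * _ * _).
rewrite -sum_tau_exp; last by rewrite !mulf_neq0 ?invr_eq0 ?mulf_neq0.
by rewrite [in RHS]big_ltn// expr0 [RHS]addrC addKr.
Qed.

Theorem charsumE l : l != 0 -> charsum (6%:R * l) =
  P%:R ^+ 2 * phi (3%:R * l) * \sum_(s | s != 0) phi (s * curve_poly l s)
  + P%:R * (p - 2)%:R.
Proof.
move=> l0; have six0 : 6%:R != 0 :> 'F_p by rewrite (natrM _ 2 3) mulf_neq0.
rewrite charsum_orth ?mulf_neq0//.
have := quad_sumE P%:R two_neq0 three_neq0 phi0 phiM phi_sqr sum_phi l0.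
by rewrite card_Fp.
Qed.

Lemma exists_sqrt u : phi u = 1 -> exists v, v ^+ 2 = u.
Proof.
have [->|u0] := eqVneq u 0; first by exists 0; rewrite expr0n.
rewrite /phi -(tauX tau1 tauM) => /tau_inj1 uh.
pose rs := [seq v <- enum 'F_p | v != 0].
have hrs : all P.-unity_root rs.
  apply/allP => v; rewrite mem_filter => /andP[v0 _].
  by rewrite unity_rootE (expFp_pred p_pr v0).
have urs : uniq rs by rewrite filter_uniq// enum_uniq.
have srs : (P <= size rs)%N.
  rewrite size_filter -sum1_count big_enum_cond/= sum1_card.
  rewrite (eq_card (B := predC1 (0 : 'F_p))); last by move=> v; rewrite !inE.
  by rewrite cardC1 card_Fp//; lia.
have /hasP[g _ gP] := has_prim_root P_gt0 hrs urs srs.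
have [i' ui] := prim_rootP gP (expFp_pred p_pr u0).
move: (i' : nat) ui => i ui {i'}.
(* Here u = g^i with g of order p-1 = 2h, so u^h = 1 forces i to be even. *)
have : g ^+ (i * h) == 1 by rewrite exprM -ui uh.
rewrite -(prim_order_dvd gP) => d.
have {d} : (2 * h %| i * h)%N by rewrite mul2n -PE.
rewrite dvdn_pmul2r// => /dvdnP[k ik].
by exists (g ^+ k); rewrite -exprM -ik.
Qed.

Lemma card_sqrt c : (#|[set y : 'F_p | y ^+ 2 == c]|)%:R = 1 + phi c.
Proof.
have [->|c0] := eqVneq c 0.
  rewrite phi0 addr0 (_ : [set y | _] = [set 0]) ?cards1//.
  by apply/setP => y; rewrite !inE expf_eq0.
have [/eqP c1|c1] := boolP (phi c == 1).
  have [y0 e] := exists_sqrt c1.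
  rewrite (_ : [set y | _] = [set y0; - y0]); last first.
    by apply/setP => y; rewrite !inE -e eqf_sqr.
  have y00 : y0 != 0 by apply: contraNneq c0 => y00; rewrite -e y00 expr0n.
  have y01 : y0 != - y0 by rewrite -subr_eq0 opprK -mulr2n -mulr_natl mulf_neq0.
  by rewrite cards2 c1 y01.
have -> : phi c = -1.
  by have := phi_sqr c0 => /eqP; rewrite sqrf_eq1 (negPf c1) => /eqP.
rewrite subrr (_ : [set y | _] = set0) ?cards0//; apply/setP => y; rewrite !inE.
apply: contraNF c1 => /eqP yc; have y0 : y != 0.
  by apply: contraNneq c0 => y0; rewrite -yc y0 expr0n.
by rewrite -yc -[y ^+ 2]mul1r (phi_mul_sqr phiM phi_sqr)// (phi1 phiM phi_sqr).
Qed.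

Lemma card_affine_DIK l : (#|affine_DIK l|)%:R =
  p%:R + phi (3%:R * l) + \sum_(s | s != 0) phi (s * curve_poly l s).
Proof.
pose f (x : 'F_p) := x ^+ 3 + 3%:R * l * (x + 1) ^+ 2.
have -> : #|affine_DIK l| = (\sum_(x : 'F_p) #|[set y : 'F_p | y ^+ 2 == f x]|)%N.
  rewrite -sum1_card (eq_bigl (fun v : 'F_p * 'F_p => v.2 ^+ 2 == f v.1)).
    rewrite -(pair_big_dep predT (fun x y : 'F_p => y ^+ 2 == f x) (fun _ _ => 1%N))/=.
    by apply: eq_bigr => x _; rewrite sum1dep_card.
  by move=> v; rewrite inE.
rewrite natr_sum; under eq_bigr do rewrite card_sqrt.
rewrite big_split/= sumr_const card_Fp// (sum_phi_DIK phiM phi_sqr) addrA.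
by []. Qed.

End CharSum.

(** * The hypergeometric coefficients *)

Lemma floor_frac_part (m : int) (d n : nat) (q : int) : (n < d)%N ->
  m = q * d%:Z + n%:Z ->
  Num.floor (m%:~R / d%:R : rat) = q /\ frac_part (m%:~R / d%:R) = n%:R / d%:R.
Proof.
move=> nd e; have d0 : (0 < d%:R :> rat) by rewrite ltr0n; lia.
have x : m%:~R / d%:R = q%:~R + n%:R / d%:R :> rat.
  by rewrite e intrD intrM mulrDl mulfK ?gt_eqF.
have fl : Num.floor (m%:~R / d%:R : rat) = q.
  apply: floor_def; rewrite x lerDl divr_ge0 ?ler0n//= intrD ltrD2l.
  by rewrite ltr_pdivrMr// mul1r ltr_nat.
by split=> //; rewrite /frac_part fl x addrC addKr.
Qed.

(** [ratr] divides by the reduced denominator, which is a unit because it divides b. *)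
Lemma ratr_nat_div (R : comUnitRingType) (a b : nat) :
  (0 < b)%N -> (b%:R : R) \is a GRing.unit ->
  ratr (a%:R / b%:R) = a%:R / b%:R :> R.
Proof.
move=> b0 ub; set x : rat := a%:R / b%:R.
have bQ : b%:R != 0 :> rat by rewrite pnatr_eq0 -lt0n.
have e : numq x * b%:Z = a%:Z * denq x.
  apply: (@intr_inj rat); rewrite !intrM -!pmulrn.
  have dQ : (denq x)%:~R != 0 :> rat by rewrite intr_eq0 denq_neq0.
  apply: (mulIf (invr_neq0 dQ)); rewrite mulfK// mulrAC divq_num_den.
  by rewrite /x divfK.
have [k bk] : exists k, b%:Z = k * denq x.
  apply/dvdzP; rewrite -(Gauss_dvdzr _ (_ : coprimez (denq x) (numq x))).
    by rewrite e dvdz_mull.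
  by rewrite /coprimez gcdzC; exact: coprime_num_den.
have ub' : ((denq x)%:~R : R) \is a GRing.unit.
  have : (b%:Z)%:~R \is a @GRing.unit R by rewrite -pmulrn.
  by rewrite bk intrM unitrM => /andP[].
rewrite /ratr; apply: (mulIr ub); rewrite divrK//.
apply: (mulIr ub'); rewrite mulrAC divrK//.
have := congr1 (fun z : int => z%:~R : R) e.
by rewrite !intrM -!pmulrn.
Qed.

Lemma regroup_factors (F : fieldType) (x x' y y' z z' w w' : F) :
  x * y * (z / w) * (x' * y' * (z' / w')) = x * x' * (y * y') * (z * z' / (w * w')).
Proof. by rewrite invfM; ring. Qed.

Section Terms.
Variables (p : nat) (p_pr : prime p).
Hypothesis p_gt3 : (3 < p)%N.
Local Notation Zp := (padic_int p_pr).
Local Notation Qp := (padic_num p_pr).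
Local Notation tofrac := (@tofrac Zp).
Local Notation Gam := (@padic_Gamma p p_pr).
Local Notation gam := (gam p_pr).
Local Notation pfrac := (pfrac p_pr).
Local Notation P := p.-1.
Local Notation h := (p.-1./2).
Implicit Types (r j s : nat).

Definition Gamma_half s : Qp := tofrac (Gam (pfrac s / 2%:R)).

Lemma Gamma_rat_pfrac s : Gamma_rat p_pr (s%:R / P%:R) = gam s.
Proof.
rewrite /Gamma_rat ratr_nat_div//; first by lia.
exact: pred_unit.
Qed.

Lemma Gamma_rat_half s : Gamma_rat p_pr (s%:R / (2 * P)%N%:R) = Gamma_half s.
Proof.
have u2 := two_unit p_pr p_gt3; have uP := pred_unit p_pr p_gt3.
rewrite /Gamma_rat ratr_nat_div; [|by lia|].
  by rewrite natrM invrM// mulrA.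
by rewrite natrM unitrM u2.
Qed.

Lemma Gamma_half_add s :
  Gamma_half (s + P) = tofrac (Gam (pfrac s / 2%:R + 2%:R^-1)).
Proof.
by rewrite /Gamma_half pfracD (pfrac_pred p_pr p_gt3) mulrDl mul1r.
Qed.

Let P_gt0 : (0 < P)%N. Proof. by lia. Qed.
Let P2_gt0 : (0 < 2 * P)%N. Proof. by lia. Qed.
Let PE : P = h.*2. Proof. exact: prime_gt3_pred. Qed.
Let PQ : P%:R != 0 :> rat.
Proof. by rewrite pnatr_eq0 -lt0n. Qed.
Let hQ : P%:R = 2%:R * h%:R :> rat.
Proof. by rewrite {1}PE -mul2n natrM. Qed.
Let h0 : h%:R != 0 :> rat.
Proof. by rewrite pnatr_eq0 -lt0n; lia. Qed.

Lemma floor_diff (a j : nat) : (a < P)%N -> (j < P)%N ->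
  Num.floor (a%:R / P%:R - j%:R / P%:R : rat) = - (a < j)%:Z /\
  frac_part (a%:R / P%:R - j%:R / P%:R) = ((a + (P - j)) %% P)%:R / P%:R.
Proof.
move=> aP jP.
have -> : a%:R / P%:R - j%:R / P%:R = (a%:Z - j%:Z)%:~R / P%:R :> rat.
  by rewrite rmorphB /= -!pmulrn mulrBl.
apply: floor_frac_part; first by rewrite ltn_mod.
case: (ltnP a j) => aj; last first.
  have -> : (a + (P - j) = (a - j) + P)%N by lia.
  by rewrite modnDr modn_small//=; lia.
by rewrite modn_small//=; lia.
Qed.

Lemma floor_sum2 (a j : nat) :
  Num.floor (a%:R / (2 * P)%N%:R + j%:R / P%:R : rat) = ((a + 2 * j) %/ (2 * P))%N%:Z /\
  frac_part (a%:R / (2 * P)%N%:R + j%:R / P%:R) = ((a + 2 * j) %% (2 * P))%N%:R / (2 * P)%N%:R.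
Proof.
have -> : a%:R / (2 * P)%N%:R + j%:R / P%:R = ((a + 2 * j)%N%:Z)%:~R / (2 * P)%N%:R :> rat.
  by rewrite -pmulrn (natrD _ a) !natrM; field; rewrite PQ.
apply: floor_frac_part; first by rewrite ltn_mod.
by rewrite {1}(divn_eq (a + 2 * j) (2 * P)) PoszD PoszM.
Qed.

Lemma frac_part_small (a d : nat) : (a < d)%N -> frac_part (a%:R / d%:R) = a%:R / d%:R.
Proof.
move=> ad; have [|_] := @floor_frac_part a%:Z d a 0 ad; first by rewrite mul0r add0r.
by rewrite -pmulrn.
Qed.

(** Since p-1 = 2h, this is the residue of both h - r, an exponent of the inverse of omega, and -h -
    r, the numerator of -1/2 - r/(p-1). *)
Definition half_exp r : nat := ((h + (P - r)) %% P)%N.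

Lemma frac_half r : (r < P)%N ->
  frac_part (- (1 / 2%:R) - r%:R / P%:R) = (half_exp r)%:R / P%:R.
Proof.
move=> rP; have -> : - (1 / 2%:R) - r%:R / P%:R = (- (h + r)%N%:Z)%:~R / P%:R :> rat.
  by rewrite rmorphN/= -pmulrn natrD hQ; field; rewrite h0.
pose q : int := if (r <= h)%N then -1 else -2.
have [||_ ->//] := @floor_frac_part (- (h + r)%N%:Z) P (half_exp r) q; first by rewrite ltn_mod.
rewrite /half_exp /q; case: leqP => rh.
  have -> : (h + (P - r) = (h - r) + P)%N by lia.
  by rewrite modnDr modn_small; lia.
by rewrite modn_small; lia.
Qed.

Lemma frac_half_diff r j : (r < P)%N -> (j < P)%N ->
  frac_part (- (1 / 2%:R) - r%:R / P%:R - j%:R / P%:R) =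
  ((h + (P - r) + (P - j)) %% P)%:R / P%:R.
Proof.
move=> rP jP.
have -> : - (1 / 2%:R) - r%:R / P%:R - j%:R / P%:R =
    (- (h + r + j)%N%:Z)%:~R / P%:R :> rat.
  by rewrite rmorphN/= -pmulrn !natrD hQ; field; rewrite h0.
set n := (_ %% P)%N.
(* As P = 2h, the sum h + (P - r) + (P - j) equals -(h + r + j) + 3P. *)
pose q : int := ((h + (P - r) + (P - j)) %/ P)%N%:Z - 3%:Z.
have [||_ ->//] := @floor_frac_part (- (h + r + j)%N%:Z) P n q; first by rewrite ltn_mod.
have := divn_eq (h + (P - r) + (P - j)) P; rewrite -/n /q; lia.
Qed.

(** The exponent of -p coming from the four floors; a comparison such as [r < j] is minus the floor
    of (r - j)/(p-1). *)
Definition G22_exp r j : int :=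
  (r < j)%N%:Z - ((r + 2 * j) %/ (2 * P))%N%:Z +
  ((half_exp r < j)%N%:Z - ((r + P + 2 * j) %/ (2 * P))%N%:Z).

(** The two arguments differ by p-1 modulo 2(p-1), so in some order they are the residue modulo p-1
    and that residue plus p-1, the shape needed for duplication. *)
Lemma Gamma_half_wrap s j :
  Gamma_half ((s + 2 * j) %% (2 * P)) * Gamma_half ((s + P + 2 * j) %% (2 * P)) =
  Gamma_half ((s + 2 * j) %% P) * Gamma_half ((s + 2 * j) %% P + P).
Proof.
set m := (s + 2 * j)%N; have -> : (s + P + 2 * j = m + P)%N by rewrite /m; lia.
set c := (m %% (2 * P))%N.
have cP : (c < 2 * P)%N by rewrite ltn_mod.
have mP : (m %% P = c %% P)%N by rewrite /c modn_dvdm// dvdn_mull.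
have m2 : ((m + P) %% (2 * P) = (c + P) %% (2 * P))%N by rewrite /c modnDml.
rewrite mP m2; case: (ltnP c P) => h1.
  by rewrite (modn_small h1) modn_small//; lia.
have -> : (c + P = (c - P) + 2 * P)%N by lia.
rewrite modnDr (modn_small (_ : c - P < 2 * P)%N); last by lia.
have -> : (c %% P = c - P)%N by rewrite -{1}(subnK h1) modnDr modn_small//; lia.
by rewrite subnK// mulrC.
Qed.

Lemma G22E r : (0 < r < P)%N -> G22 p_pr r 1 = - 1 / P%:R *
  \sum_(0 <= j < P) (- p%:R) ^ (G22_exp r j) *
    (gam ((r + (P - j)) %% P) / gam r *
     (gam ((h + (P - r) + (P - j)) %% P) / gam (half_exp r))) *
    ((Gamma_half ((r + 2 * j) %% P) * Gamma_half ((r + 2 * j) %% P + P)) /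
     (Gamma_half r * Gamma_half (r + P))).
Proof.
move=> /andP[r0 rP]; rewrite /G22 /nGn.
set u : rat := _ / P%:R; set v : rat := _ / (2 * P)%N%:R.
set w : rat := - (1 / 2%:R) - u; set v' : rat := - v - 1 / 2%:R.
congr (_ * _); apply: eq_big_nat => j /andP[_ jP].
rewrite !big_ord_recl big_ord0 !(tnth_nth 0) mulr1.
rewrite ![tval _]/= ![nat_of_ord _]/= /bump ![nth _ _ _]/=.
set uj : rat := j%:R / P%:R.
have q1 : frac_part u = u by exact: frac_part_small.
have [q2 q3] : Num.floor (u - uj) = - (r < j)%N%:Z /\
    frac_part (u - uj) = ((r + (P - j)) %% P)%:R / P%:R by exact: floor_diff.
have q4 : frac_part w = (half_exp r)%:R / P%:R by exact: frac_half.
have hlt : (half_exp r < P)%N by rewrite ltn_mod.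
have [q5 _] := floor_diff hlt jP; rewrite -/uj in q5.
have q6 : frac_part (w - uj) = ((h + (P - r) + (P - j)) %% P)%:R / P%:R.
  exact: frac_half_diff.
have rP2 : (r < 2 * P)%N by lia.
have q7 : frac_part (- - v) = v by rewrite opprK; exact: frac_part_small.
have [q8 q9] := floor_sum2 r j; rewrite -/v -/uj in q8 q9.
have v'E : - v' = (r + P)%N%:R / (2 * P)%N%:R.
  rewrite /v' /v natrD natrM; field; exact: PQ.
have q10 : frac_part (- v') = - v' by rewrite v'E; apply: frac_part_small; lia.
have [q11 q12] := floor_sum2 (r + P) j; rewrite -v'E -/uj in q11 q12.
rewrite q3 q6 q4 q5 q7 q10 q1 q2 q8 q11 !opprK q9 q12 v'E /u /v.
rewrite !Gamma_rat_pfrac // !Gamma_rat_half //.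
have -> : (-1 : Qp) ^+ (j * 2) = 1 by rewrite mulnC exprM expr2 mulrNN mulr1 expr1n.
have -> : char_pow (char_inv (omega p_pr)) j 1 = 1.
  by rewrite /char_pow oner_eq0 /char_inv (omega1 p_pr) invr1 expr1n.
have pN : - p%:R != 0 :> Qp by rewrite oppr_eq0; exact: padic_num_p_neq0.
rewrite -(Gamma_half_wrap r j) /G22_exp [in RHS](expfzDr _ _ pN) mulr1 mul1r.
exact: regroup_factors.
Qed.

End Terms.

(** The algebra of [summandE]: [J2] and [J4] are the 2-fold and 4-fold Jacobi sums; [gh], [gr],
    [ga], [gn] are [gam] at (p-1)/2, r, [half_exp p r] and p-1-r; [s] is (-1)^r; [v] and [w] are
    omega(2)^r and omega(4)^j. *)
Lemma jacobi_product (F : fieldType)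
  (q s f w v X2 X4 Xe J2 J4 gh gr ga gn g1 g2 g3 : F) :
  q != 0 -> v != 0 -> gh != 0 -> gr != 0 -> ga != 0 ->
  J2 * gh = - (gr * ga) * X2 -> J4 * gh = - (g1 * g2 * g3 * gn) * X4 ->
  gr * gn = - s -> Xe * X2 * - q = X4 ->
  s * f / q * J2 * (Xe * (g1 / gr * (g2 / ga)) *
    ((gh * (v * w) * g3) / (gh * v * gr))) = f / q ^+ 2 * (w * J4).
Proof.
move=> q0 v0 gh0 gr0 ga0 e2 e4 es eX.
have -> : J2 = - (gr * ga) * X2 / gh by rewrite -e2 mulfK.
have -> : J4 = - (g1 * g2 * g3 * gn) * X4 / gh by rewrite -e4 mulfK.
have -> : s = - (gr * gn) by rewrite es opprK.
by rewrite -eX; field; rewrite q0 v0 gh0 gr0 ga0.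
Qed.

Lemma collect_terms (F : fieldType) (q P f f1 f3 C S : F) :
  q != 0 -> P != 0 -> f * f1 = f3 -> f3 ^+ 2 = 1 ->
  C = P ^+ 2 * f3 * S + P * (P - 1) ->
  q ^+ 2 * f / P * (f1 / q ^+ 2 * (- 1 / P) * C) = f3 / P + (- f3 - S).
Proof.
move=> q0 P0 ef f31 ->.
transitivity (- (f * f1) * f3 * S + (f * f1) / P - f * f1).
  by field; rewrite q0 P0.
by rewrite ef mulNr -expr2 f31; ring.
Qed.

Lemma regroup_sum (R : comPzRingType) (B c T K w w' J : R) :
  B * T = K * (w' * J) -> w * B * (c * T) = K * c * (w * w' * J).
Proof.
move=> e; have -> : w * B * (c * T) = w * c * (B * T) by ring.
by rewrite e; ring.
Qed.

Lemma divn_unique_int (P n b : nat) (e : int) : (b < P)%N ->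
  n%:Z = e * P%:Z + b%:Z -> (n %% P = b)%N /\ (n %/ P)%N%:Z = e.
Proof.
move=> bP en; have := divn_eq n P; have := ltn_pmod n (_ : 0 < P)%N.
move=> /(_ ltac:(lia)); move: (n %/ P)%N (n %% P)%N => q r rP eq.
have [lt|gt|e1] := ltgtP (q%:Z) e; [nia|nia|].
by split=> //; move: en; rewrite -e1 eq; lia.
Qed.

(** * Term-by-term comparison with 4-fold Jacobi sums *)

Section Assembly.
Variables (p : nat) (p_pr : prime p).
Hypothesis p_gt3 : (3 < p)%N.
Local Notation Qp := (padic_num p_pr).
Local Notation gam := (gam p_pr).
Local Notation P := p.-1.
Local Notation h := (p.-1./2).
Local Notation omega := (omega p_pr).
Local Notation phi := (phi omega).
Local Notation jac := (jacobi_conv omega).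
Implicit Types (r j s : nat).

Let P_gt0 : (0 < P)%N. Proof. by lia. Qed.
Let PE : P = h.*2. Proof. exact: prime_gt3_pred. Qed.
Let hP : (h < P)%N. Proof. by lia. Qed.

Lemma half_expE r : (r < P)%N -> (r + half_exp p r = (h < r) * P + h)%N.
Proof.
move=> rP; rewrite /half_exp; case: (ltnP h r) => hr /=.
  by rewrite modn_small; lia.
have -> : (h + (P - r) = (h - r) + P)%N by lia.
by rewrite modnDr modn_small; lia.
Qed.

(** In r - j, h - r - j, r + 2j and -r everything cancels but h; the quotient counts the reductions
    modulo p-1, which the floors in [G22_exp] also count. *)
Lemma quad_exps_sum r j : (0 < r < P)%N -> (j < P)%N ->
  (sumn (quad_exps p r j) %% P = h)%N /\
  (sumn (quad_exps p r j) %/ P)%N%:Z = G22_exp p r j + (h < r)%N%:Z + 1.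
Proof.
move=> /andP[r0 rP] jP; apply: divn_unique_int => //.
have e1 : ((r + (P - j)) %% P)%N%:Z = r%:Z - j%:Z + (r < j)%N%:Z * P%:Z.
  case: (ltnP r j) => rj; first by rewrite modn_small; lia.
  have -> : (r + (P - j) = (r - j) + P)%N by lia.
  by rewrite modnDr modn_small; lia.
have a2 := half_expE rP.
have hlt : (half_exp p r < P)%N by rewrite ltn_mod.
have e2 : ((h + (P - r) + (P - j)) %% P)%N%:Z =
    (half_exp p r)%:Z - j%:Z + (half_exp p r < j)%N%:Z * P%:Z.
  rewrite -modnDml -/(half_exp p r); move: (half_exp p r) hlt {a2} => a aP.
  case: (ltnP a j) => aj; first by rewrite modn_small; lia.
  have -> : (a + (P - j) = (a - j) + P)%N by lia.
  by rewrite modnDr modn_small; lia.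
have e3 := divn_eq (r + 2 * j) P.
(* Hermite's identity floor(t) + floor(t + 1/2) = floor(2t), at t = (r + 2j)/(2P). *)
have e4 : ((r + 2 * j) %/ (2 * P) + (r + P + 2 * j) %/ (2 * P) = (r + 2 * j) %/ P)%N.
  rewrite (_ : r + P + 2 * j = r + 2 * j + P)%N; last by lia.
  rewrite [(2 * P)%N]mulnC !divnMA (divnDr _ (dvdnn P)) divnn P_gt0.
  by move: (_ %/ P)%N => n; lia.
rewrite /quad_exps /= /G22_exp addn0 !PoszD e1 e2.
move: e3 e4.
move: ((r + 2 * j) %/ P)%N ((r + 2 * j) %% P)%N => q3 m3.
move: ((r + 2 * j) %/ (2 * P))%N ((r + P + 2 * j) %/ (2 * P))%N => q1 q2 e3 e4.
move: (half_exp p r) a2 {hlt e2} => a a2.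
have -> : m3%:Z = r%:Z + 2 * j%:Z - (q1%:Z + q2%:Z) * P%:Z by nia.
have -> : (P - r)%N%:Z = P%:Z - r%:Z by lia.
have -> : a%:Z = (h < r)%N%:Z * P%:Z + h%:Z - r%:Z by lia.
ring.
Qed.

Lemma tcharE r (x : 'F_p) : char_pow (char_inv omega) r x = tchar omega r x.
Proof. by []. Qed.

Lemma quadcharE (x : 'F_p) : quadchar p_pr x = phi x.
Proof.
have o0 := omega0 p_pr; have o1 := omega1 p_pr; have oM := omegaM p_pr.
have ph0 := phi0 p_pr p_gt3 o0.
have ph2 := phi_sqr p_pr p_gt3 o1 oM.
rewrite /quadchar; case: eqP => [->|/eqP x0]; first by rewrite ph0.
case: existsP => [[y /eqP e]|ne].
  rewrite -e; have y0 : y != 0 by apply: contraNneq x0 => y0; rewrite -e y0 expr0n.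
  by rewrite expr2 (phiM oM) -expr2 (ph2 _ y0).
have := ph2 _ x0 => /eqP; rewrite sqrf_eq1 => /orP[/eqP e|/eqP->//].
have [v ve] := exists_sqrt p_pr p_gt3 o1 oM (@omega_inj1 p p_pr) e.
by case: ne; exists v; apply/eqP.
Qed.

Lemma omegaN1 : omega (- 1) = -1.
Proof.
have /eqP : omega (- 1) ^+ 2 = 1.
  by rewrite expr2 -(omegaM p_pr) mulrNN mulr1 (omega1 p_pr).
rewrite sqrf_eq1 => /orP[/eqP/omega_inj1 e|/eqP//].
have : (2%:R : 'F_p) != 0 by apply: (Fp_nat_neq0 p_pr); lia.
by rewrite -[2%:R]/(1 + 1) -{1}e addNr eqxx.
Qed.

(** The inverse of omega^(-r) phi is omega^r phi, that is, the inverse of omega raised to (p-1)/2 -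
    r. *)
Lemma char_binomE r : (0 < r < P)%N ->
  char_binom (char_pow (char_inv omega) r)
    (char_mul (char_pow (char_inv omega) r) (quadchar p_pr)) =
  (-1) ^+ r * phi (- 1) / p%:R * jac [:: r; half_exp p r] 1.
Proof.
move=> /andP[r0 rP]; have N10 : (-1 : 'F_p) != 0 by rewrite oppr_eq0 oner_neq0.
rewrite /char_binom /char_mul quadcharE; congr (_ * _ / _ * _).
  by rewrite /char_pow (negPf N10) /char_inv omegaN1 invrN1.
rewrite /jacobi_sum; apply: eq_bigr => x _; rewrite -[X in _ = _ * X]/(jac [:: half_exp p r] (1 - x)).
rewrite (jac1 omega) tcharE.
congr (_ * _); move: (1 - x) => {}x.
rewrite /char_inv quadcharE /half_exp.
rewrite (tchar_mod p_pr (omega0 p_pr) (omega1 p_pr) (omegaM p_pr)).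
rewrite /char_pow /tchar; case: eqP => [_|/eqP x0]; first by rewrite mul0r invr0.
have xP : omega x ^+ P = 1.
  by rewrite -(tauX (omega1 p_pr) (omegaM p_pr)) (expFp_pred p_pr x0) omega1.
rewrite exprD (exprV_sub p_pr p_gt3 xP (ltnW rP)) invfM /phi mulrC.
by rewrite !exprVn invrK.
Qed.

Lemma pfrac_half : pfrac p_pr h = 2%:R^-1.
Proof.
have u2 := two_unit p_pr p_gt3; have uP := pred_unit p_pr p_gt3.
have e : P%:R = 2%:R * h%:R :> padic_int p_pr by rewrite {1}PE -mul2n natrM.
by apply: (mulIr uP); rewrite /pfrac (divrK uP) e mulrA (mulVr u2) mul1r.
Qed.

Lemma Gamma_half_dup s : (s < P)%N ->
  Gamma_half p_pr s * Gamma_half p_pr (s + P) = gam h * omega 2%:R ^+ s * gam s.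
Proof.
by move=> sP; rewrite (Gamma_half_add p_pr p_gt3) (gam_dup p_pr p_gt3 sP) [gam h]gamE pfrac_half.
Qed.

(** Apart from omega(4)^j, the factor in front of the 4-fold Jacobi sum is independent of r and j,
    which makes orthogonality applicable. Reflection absorbs (-1)^r, and [quad_exps_sum] accounts
    for the powers of -p. *)
Lemma summandE r j : (0 < r < P)%N -> (j < P)%N ->
  (-1) ^+ r * phi (- 1) / p%:R * jac [:: r; half_exp p r] 1 *
  ((- p%:R) ^ (G22_exp p r j) *
    (gam ((r + (P - j)) %% P) / gam r *
     (gam ((h + (P - r) + (P - j)) %% P) / gam (half_exp p r))) *
    ((Gamma_half p_pr ((r + 2 * j) %% P) * Gamma_half p_pr ((r + 2 * j) %% P + P)) /
     (Gamma_half p_pr r * Gamma_half p_pr (r + P)))) =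
  phi (- 1) / p%:R ^+ 2 * (omega 4%:R ^+ j * jac (quad_exps p r j) 1).
Proof.
move=> r0P jP; have /andP[r0 rP] := r0P.
rewrite !Gamma_half_dup// ?ltn_mod//.
have two0 : (2%:R : 'F_p) != 0 by apply: (Fp_nat_neq0 p_pr); lia.
have o20 := tau_neq0 (omega1 p_pr) (omegaM p_pr) two0.
rewrite -(tau_mod p_pr (omega1 p_pr) (omegaM p_pr) _ two0) exprD exprM.
have -> : omega 2%:R ^+ 2 = omega 4%:R by rewrite expr2 -(omegaM p_pr) -natrM.
have hlt : (half_exp p r < P)%N by rewrite ltn_mod.
have pQ := padic_num_p_neq0 p_pr.
have pN : - p%:R != 0 :> Qp by rewrite oppr_eq0.
have [s1 s2] := quad_exps_sum r0P jP.
have s3 : sumn [:: r; half_exp p r] = ((h < r) * P + h)%N.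
  by rewrite /= addn0 half_expE.
have s4 : (sumn [:: r; half_exp p r] %% P = h)%N by rewrite s3 modnMDl modn_small.
have s5 : (sumn [:: r; half_exp p r] %/ P = (h < r))%N.
  by rewrite s3 divnMDl// divn_small ?addn0.
have h0 : (0 < h)%N by lia.
apply: (@jacobi_product _ _ _ _ _ _ ((- p%:R) ^+ (h < r)%N)
  ((- p%:R) ^+ (sumn (quad_exps p r j) %/ P)) _ _ _ _ _ _ (gam (P - r))).
- exact: pQ.
- exact: (expf_neq0 r o20).
- exact: (gam_neq0 p_pr p_gt3 hP).
- exact: (gam_neq0 p_pr p_gt3 rP).
- exact: (gam_neq0 p_pr p_gt3 hlt).
- have := @jacobi_conv_gam p p_pr p_gt3 [:: r; half_exp p r].
  rewrite s4 s5 /= rP hlt => /(_ isT h0) ->.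
  by rewrite big_cons big_seq1 expr2 mulrNN mulr1 mulN1r.
- have := @jacobi_conv_gam p p_pr p_gt3 (quad_exps p r j).
  rewrite s1 => /(_ _ h0) ->; last first.
    by rewrite /quad_exps /= !ltn_mod !P_gt0 /=; lia.
  have -> : (-1 : Qp) ^+ size (quad_exps p r j) = 1 by rewrite -signr_odd expr0.
  by rewrite mulN1r /quad_exps !big_cons big_nil mulr1 !mulrA.
- exact: (gam_reflect p_pr p_gt3 r0P).
rewrite [RHS]exprnP s2 (expfzDr _ 1 pN) (expfzDr _ _ pN) expr1z.
by [].
Qed.

End Assembly.

Theorem theorem1p2 (p : nat) (p_pr : prime p) (p_gt3 : (3 < p)%N)
    (lambda : 'F_p) (lambda_neq0 : lambda != 0)
    (lambda_neq94 : lambda != 9%:R / 4%:R) :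
  p%:R ^+ 2 * quadchar p_pr (- 3%:R * lambda) / (p.-1)%:R *
    \sum_(1 <= r < p.-1)
      char_pow (omega p_pr) r (6%:R * lambda) *
      char_binom (char_pow (char_inv (omega p_pr)) r)
        (char_mul (char_pow (char_inv (omega p_pr)) r) (quadchar p_pr)) *
      G22 p_pr r 1
  = quadchar p_pr (3%:R * lambda) / (p.-1)%:R
    + (ap_DIK lambda)%:~R :> padic_num p_pr.
Proof.
have o0 := omega0 p_pr; have o1 := omega1 p_pr; have oM := omegaM p_pr.
have oI := @omega_inj1 p p_pr.
have six0 : (6%:R * lambda : 'F_p) != 0.
  rewrite mulf_neq0// (natrM _ 2 3) mulf_neq0// (Fp_nat_neq0 p_pr)//; lia.
have three0 : (3%:R * lambda : 'F_p) != 0.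
  by rewrite mulf_neq0// (Fp_nat_neq0 p_pr)//; lia.
have -> : \sum_(1 <= r < p.-1) char_pow (omega p_pr) r (6%:R * lambda) *
      char_binom (char_pow (char_inv (omega p_pr)) r)
        (char_mul (char_pow (char_inv (omega p_pr)) r) (quadchar p_pr)) *
      G22 p_pr r 1 =
    phi (omega p_pr) (- 1) / p%:R ^+ 2 * (- 1 / (p.-1)%:R) *
      charsum (omega p_pr) (6%:R * lambda).
  rewrite /charsum mulr_sumr; apply: eq_big_nat => r /andP[r0 rP].
  have r0P : (0 < r < p.-1)%N by rewrite r0.
  rewrite (char_binomE p_pr p_gt3 r0P) (G22E p_pr p_gt3 r0P) /char_pow (negPf six0).
  have e j := @summandE p p_pr p_gt3 r j r0P.
  move: (_ / p%:R * jacobi_conv _ [:: r; _] 1) e => B e.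
  rewrite !mulr_sumr; apply: eq_big_nat => j /andP[_ jP].
  exact: (regroup_sum _ _ (e j jP)).
have PQ : (p.-1)%:R != 0 :> padic_num p_pr by apply: padic_num_natr_gt0; lia.
have oP := phiM oM.
rewrite !quadcharE//.
(* The point at infinity cancels the 1 in p + 1, so a_p is minus the sum of phi over the values of
   the cubic. *)
have -> : (ap_DIK lambda)%:~R = - phi (omega p_pr) (3%:R * lambda) -
    \sum_(s | s != 0) phi (omega p_pr) (s * curve_poly lambda s) :> padic_num p_pr.
  rewrite /ap_DIK /card_DIK -addn1 PoszD opprD addrACA subrr addr0 rmorphB/= -!pmulrn.
  rewrite (card_affine_DIK p_pr p_gt3 o0 o1 oM oI).
  by rewrite -addrA opprD addNKr opprD.
apply: collect_terms.
- exact: padic_num_p_neq0.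
- exact: PQ.
- by rewrite -oP mulrN1 mulNr opprK.
- exact: (phi_sqr p_pr p_gt3 o1 oM three0).
rewrite (charsumE p_pr p_gt3 o0 o1 oM oI lambda_neq0).
have -> : (p - 2)%:R = (p.-1)%:R - 1 :> padic_num p_pr.
  have -> : (p - 2 = p.-1 - 1)%N by lia.
  by rewrite natrB//; lia.
by [].
Qed.
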